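(* For every string $T[1,n]$ with $T[n]=\$$ as in the context, the Lyndon array $\lambda$ of $T$ can be represented in $2n+o(n)$ bits such that every value $\lambda[i]$ can be retrieved in $O(1)$ time.
   Context: $T[1,n]$ is a string over an ordered alphabet whose last symbol $T[n]=\$$ occurs nowhere else and is smaller than every other symbol. A Lyndon word is a nonempty string strictly lexicographically smaller than all of its proper rotations; the Lyndon array $\lambda[1,n]$ stores in $\lambda[i]$ the length of the longest Lyndon word starting at position $i$ of $T$. The computational model is the word RAM with words of $\Theta(\log n)$ bits. *)

(* Defs.v *)
From mathcomp Require Import all_boot all_order all_algebra.
Set Implicit Arguments.
Unset Strict Implicit.
Unset Printing Implicit Defensive.

Section Lyndon.
Context {d : Order.disp_t} {A : orderType d}.
Implicit Types s T : seq A.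

Definition lex_lt s1 s2 : bool := ((s1 : seqlexi A) < (s2 : seqlexi A))%O.

(* [rot k s] with [0 < k < size s] runs over the proper rotations of [s]; one
   of them may equal [s] as a string, and then [s] is not Lyndon. *)
Definition lyndon s : bool :=
  (s != [::]) && [forall k : 'I_(size s), (0 < k) ==> lex_lt s (rot k s)].

(* Positions are 0-based.  The bound on [l] matters, since [take] truncates. *)
Definition longest_lyndon T (i : nat) : nat :=
  \max_(l < (size T - i).+1 | lyndon (take l (drop i T))) l.

Definition lyndon_array T : seq nat := mkseq (longest_lyndon T) (size T).

Definition dollar_terminated T : Prop :=
  exists s (dollar : A),
    [/\ T = rcons s dollar, dollar \notin s
      & forall c : A, c != dollar -> (dollar < c)%O].

End Lyndon.

(* Word RAM.  A [w]-bit word is a natural number smaller than [2 ^ w];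
   arithmetic is modulo [2 ^ w], and every instruction costs one step. *)

Inductive binop := Add | Sub | Mul | Div | Mod | And | Or | Xor | Shl | Shr.

Definition eval_binop (w : nat) (o : binop) (x y : nat) : nat :=
  match o with
  | Add => (x + y) %% 2 ^ w
  | Sub => (x + 2 ^ w - y) %% 2 ^ w
  | Mul => (x * y) %% 2 ^ w
  | Div => x %/ y
  | Mod => x %% y
  | And => Nat.land x y
  | Or => Nat.lor x y
  | Xor => Nat.lxor x y
  | Shl => (x * 2 ^ y) %% 2 ^ w
  | Shr => x %/ 2 ^ y
  end.

(* Registers [rd], [ra], [rb] are named by fixed numbers, so that a program
   uses finitely many of them; [Read] and [Write] address the memory
   indirectly through [ra]. *)
Inductive instr :=
  | Const (rd c : nat)
  | Op (o : binop) (rd ra rb : nat)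
  | Read (rd ra : nat)
  | Write (ra rb : nat)
  | Jump (k : nat)
  | JumpEq (ra rb k : nat)
  | JumpLt (ra rb k : nat).

Definition program := seq instr.

Record config := Config { pc : nat; reg : nat -> nat; mem : nat -> nat }.

Definition exec (w : nat) (ins : instr) (c : config) : config :=
  let: Config p r m := c in
  match ins with
  | Const rd x => Config p.+1 [eta r with rd |-> x %% 2 ^ w] m
  | Op o rd ra rb =>
      Config p.+1 [eta r with rd |-> eval_binop w o (r ra) (r rb)] m
  | Read rd ra => Config p.+1 [eta r with rd |-> m (r ra)] m
  | Write ra rb => Config p.+1 r [eta m with r ra |-> r rb]
  | Jump k => Config k r m
  | JumpEq ra rb k => Config (if r ra == r rb then k else p.+1) r m
  | JumpLt ra rb k => Config (if r ra < r rb then k else p.+1) r m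
  end.

Definition halted (P : program) (c : config) : bool := size P <= pc c.

(* A halted configuration is left unchanged. *)
Definition step (w : nat) (P : program) (c : config) : config :=
  if onth P (pc c) is Some ins then exec w ins c else c.

Definition is_word (w x : nat) : bool := x < 2 ^ w.

Definition stores (M : seq nat) (m : nat -> nat) : Prop :=
  forall a, a < size M -> m a = nth 0 M a.

(* On argument [x] (in register 0), [P] returns [y] (in register 0) within [t]
   steps.  Memory outside [M] and the other registers initially hold arbitrary
   words, so the answer depends on [M] and [x] only; [M] is intact at the end,
   so that queries can be repeated. *)
Definition answers (w : nat) (P : program) (t : nat) (M : seq nat)
    (x y : nat) : Prop :=
  forall c : config,
    pc c = 0 -> reg c 0 = x -> stores M (mem c) ->
    (forall j, is_word w (reg c j)) -> (forall a, is_word w (mem c a)) ->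
  let c' := iter t (step w P) c in
  [/\ halted P c', reg c' 0 = y & stores M (mem c')].

(* Word size [Theta(log n)] for inputs of length [n].  The first clause is the
   usual requirement that [n] itself fits into a word, and gives the lower
   bound [trunc_log 2 n < w n]. *)
Definition log_word_size (w : nat -> nat) : Prop :=
  (forall n, is_word (w n) n) /\
  (exists C N : nat, forall n, N <= n -> w n <= C * trunc_log 2 n).

(* r(n) = o(n) *)
Definition little_o_n (r : nat -> nat) : Prop :=
  forall eps : rat, (0 < eps)%R ->
  exists N : nat, forall n, N <= n -> ((r n)%:R <= eps * n%:R)%R.

(* Main.v *)
(* Writing [next i = i + lambda[i]], the intervals [[i, next i)] are pairwise
   nested or disjoint, because two properly overlapping Lyndon factors merge
   into a longer one.  Let [V k] be the number of distinct endpoints [> k] of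
   intervals that start before [k], and let [h i] be the same count at [i] once
   the interval of [i] is added.  Both [h i - V i] and [h i - V i.+1] are 0 or
   1, which is two bits per position, and [next i] is the first [k > i] with
   [V k < h i].

   The walk [V] is cut into micro-blocks of about [w / 8C] positions, whose
   two-bit codes are so short that every question about one micro-block is a
   lookup in a table of [O(sqrt n)] words.  About [log w] micro-blocks form a
   block; the heights at which micro-blocks start and their minima, relative to
   the start of the block, again form a code that is short enough for tables.
   There remain the queries that leave their block [X].  The first later block
   whose minimum is below a threshold [t] is a step function of [X] and [t].
   At each of its jumps inside the range of [X], the block [Y] jumped to has
   [X] as last predecessor with a minimum that is not larger, so there are at
   most two jumps per block, and a sparse rank structure of [o(n)] bits
   evaluates the step function. *)
Require Import Defs.
From mathcomp Require Import all_boot all_order all_algebra.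
From Stdlib Require PeanoNat.
From mathcomp Require Import zify.
Set Implicit Arguments.
Unset Strict Implicit.
Unset Printing Implicit Defensive.

Import Order.TTheory GRing.Theory Num.Theory.


(** * Lyndon words *)

Section LyndonWords.
Context {d : Order.disp_t} {A : orderType d}.
Implicit Types s t u v T : seq A.

(** The strict lexicographic order without the proper-prefix case: the strings must differ at a
    position inside both. Unlike [lex_lt], this relation survives appending arbitrary strings to
    both sides. *)
Fixpoint mismatch_lt s t : bool :=
  match s, t with
  | a :: s', b :: t' => (a < b)%O || (a == b) && mismatch_lt s' t'
  | _, _ => false
  end.

Lemma mismatch_ltW s t : mismatch_lt s t -> lex_lt s t.
Proof.
rewrite /lex_lt; elim: s t => [|a s IH] [|b t] //=; rewrite Order.SeqLexiOrder.ltxi_cons.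
case/orP=> [ab|/andP[/eqP-> /IH st]]; last by rewrite lexx /= st.
by rewrite (ltW ab) /= leNgt ab.
Qed.

(** A string at least as long as [t] cannot precede [t] by being a proper prefix of it. *)
Lemma lex_lt_mismatch s t : size t <= size s -> lex_lt s t -> mismatch_lt s t.
Proof.
rewrite /lex_lt; elim: s t => [|a s IH] [|b t] //= sz; rewrite Order.SeqLexiOrder.ltxi_cons.
by case: (ltgtP a b) => //= _; apply: IH.
Qed.

Lemma mismatch_lt_cat s t u v : mismatch_lt s t -> mismatch_lt (s ++ u) (t ++ v).
Proof.
elim: s t => [|a s IH] [|b t] //= /orP[->//|/andP[-> /IH->]]; by rewrite orbT.
Qed.

Lemma mismatch_lt_catE s t u v : size s = size t ->
  mismatch_lt (s ++ u) (t ++ v) = mismatch_lt s t || (s == t) && mismatch_lt u v.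
Proof.
elim: s t => [|a s IH] [|b t] //= [/IH->].
rewrite eqseq_cons; case: (a == b); by rewrite ?orbF //= ?orbA.
Qed.

Lemma mismatch_lt_asym s t : mismatch_lt s t -> ~~ mismatch_lt t s.
Proof.
elim: s t => [|a s IH] [|b t] //=; case: (ltgtP a b) => //= _ ; exact: IH.
Qed.

Lemma mismatch_ltxx s : mismatch_lt s s = false.
Proof. by apply/negP => H; move: (mismatch_lt_asym H); rewrite H. Qed.

Lemma mismatch_lt_trans t s u : mismatch_lt s t -> mismatch_lt t u -> mismatch_lt s u.
Proof.
elim: s t u => [|a s IH] [|b t] [|c u] //=.
case/orP=> [ab|/andP[/eqP-> st]] /orP[bc|/andP[/eqP<- tu]].
- by rewrite (lt_trans ab bc).
- by rewrite ab.
- by rewrite bc.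
- by rewrite eqxx (IH _ _ st tu) orbT.
Qed.

(** Replaces rotations by suffixes. A mismatch with a suffix is also one with the rotation that
    extends it; the other direction has to exclude that a proper suffix is also a prefix. *)
Lemma lyndonP s :
  reflect (s <> [::] /\ forall k, 0 < k < size s -> mismatch_lt s (drop k s)) (lyndon s).
Proof.
apply: (iffP andP) => [[/eqP s0 /forallP rots]|[/eqP s0 sufs]]; split=> //.
  have rot_lt k : 0 < k < size s -> mismatch_lt s (rot k s).
    case/andP=> k0 ks; apply: lex_lt_mismatch; first by rewrite size_rot.
    by have /implyP := rots (Ordinal ks); apply.
  move=> k /andP[k0 ks]; have vs : size (drop k s) = size s - k by rewrite size_drop.
  set v := drop k s in vs *; set u := take k s.
  have us : size u = k by rewrite size_takel // ltnW.
  have := rot_lt k; rewrite k0 ks => /(_ isT).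
  rewrite -{1}(cat_take_drop (size v) s) /rot -/v -/u mismatch_lt_catE; last first.
    by rewrite size_takel // vs leq_subr.
  case/orP=> [lt_v|/andP[/eqP pre lt_u]].
    by have := mismatch_lt_cat (drop (size v) s) [::] lt_v; rewrite cat_take_drop cats0.
  (* Here the suffix [v] is also a prefix, so [s = u v = v u']. Rotating by [k] gave [u' < u];
     rotating by [size v] gives [u < u']. *)
  have := rot_lt (size v); rewrite vs subn_gt0 ks ltn_subrL k0 (leq_trans _ ks) // => /(_ isT).
  rewrite -{1}(cat_take_drop k s) /rot -/u -/v -vs mismatch_lt_catE; last first.
    by rewrite size_drop us vs subKn // ltnW.
  rewrite pre mismatch_ltxx andbF orbF => lt_u'.
  by have := mismatch_lt_asym lt_u; rewrite lt_u'.
apply/forallP=> k; apply/implyP=> k0; apply: mismatch_ltW.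
rewrite /rot -{1}(cats0 s); apply: mismatch_lt_cat; apply: sufs; by rewrite k0 ltn_ord.
Qed.

(** A suffix starting before [l] is decided inside the Lyndon prefix. A later one is larger than
    [drop k s], which itself starts before [l]. *)
Lemma lyndon_overlap s k l : k < l -> l <= size s ->
  lyndon (take l s) -> lyndon (drop k s) -> lyndon s.
Proof.
move=> kl ls /lyndonP[u0 hu] /lyndonP[v0 hv]; apply/lyndonP; split.
  by move=> s0; move: u0; rewrite s0.
have small j : 0 < j < l -> mismatch_lt s (drop j s).
  move=> /andP[j0 jl]; rewrite -(cat_take_drop l s) drop_cat size_takel // jl.
  by apply/mismatch_lt_cat/hu; rewrite j0 size_takel.
case: (posnP k) => [k0|k0].
  by move: hv; rewrite k0 drop0.
move=> j /andP[j0 js]; case: (ltnP j l) => jl; first by apply: small; rewrite j0.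
apply: (@mismatch_lt_trans (drop k s)); first by apply: small; rewrite k0.
have -> : drop j s = drop (j - k) (drop k s) by rewrite drop_drop; congr drop; lia.
by apply: hv; rewrite size_drop; lia.
Qed.

Variable T : seq A.

Lemma longest_lyndonP i : i < size T ->
  let l := longest_lyndon T i in
  [/\ 0 < l, i + l <= size T, lyndon (take l (drop i T))
    & forall k, i + k <= size T -> lyndon (take k (drop i T)) -> k <= l].
Proof.
move=> iT /=.
have max_ge k : i + k <= size T -> lyndon (take k (drop i T)) -> k <= longest_lyndon T i.
  move=> kT lk; have ks : k < (size T - i).+1 by lia.
  exact: (leq_bigmax_cond (Ordinal ks) lk).
have lyn1 : lyndon (take 1 (drop i T)).
  apply/lyndonP; have sz : size (take 1 (drop i T)) = 1 by rewrite size_takel // size_drop; lia.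
  split=> [E|k]; first by rewrite E in sz.
  by rewrite sz; lia.
have l0 := max_ge 1 ltac:(lia) lyn1.
have [] := @eq_bigmax_cond _ [pred l : 'I_(size T - i).+1 | lyndon (take l (drop i T))]
  (fun l => val l).
  have h1 : 1 < (size T - i).+1 by lia.
  by apply/card_gt0P; exists (Ordinal h1).
move=> l; rewrite inE => ll el; have {}el : longest_lyndon T i = l by exact: el.
have := ltn_ord l; rewrite el in l0 max_ge *; move=> lT.
by split=> //; move: (size T) (val l) lT iT => a b; lia.
Qed.

(** A crossing would let [lyndon_overlap] merge the two factors into a Lyndon word at [i] longer
    than the longest one. *)
Lemma longest_lyndon_noncrossing i j : j < size T -> i < j < i + longest_lyndon T i ->
  j + longest_lyndon T j <= i + longest_lyndon T i.
Proof.
move=> jT /andP[ij je]; have [] := longest_lyndonP jT.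
have [|] := @longest_lyndonP i; first lia.
set li := longest_lyndon T i; set lj := longest_lyndon T j.
move=> li0 liT lyni maxi lj0 ljT lynj _; rewrite leqNgt; apply/negP=> cross.
suff : j + lj - i <= li by lia.
apply: maxi; first lia.
have sz : size (take (j + lj - i) (drop i T)) = j + lj - i by rewrite size_takel ?size_drop; lia.
apply: (@lyndon_overlap _ (j - i) li); rewrite ?sz; try lia.
  by rewrite take_takel //; lia.
have -> : j + lj - i = lj + (j - i) by lia.
by rewrite -take_drop drop_drop subnK // ltnW.
Qed.

End LyndonWords.

(** * The walk of a non-crossing successor map *)

Section Walk.
Variables (n : nat) (next : nat -> nat).
Hypothesis next_gt : forall i, i < n -> i < next i <= n.
Hypothesis next_noncrossing : forall i j, j < n -> i < j < next i -> next j <= next i.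

(** [height] and [threshold] are the [V] and [h] of the overview. The ends form a set because an end
    shared by several intervals must count once if the walk is to fall by at most one per
    position. *)
Definition open_ends (k i : nat) : {set 'I_n.+1} :=
  [set e : 'I_n.+1 | (i < e) && [exists a : 'I_n, (a < k) && (next a == e)]].
Definition height i := #|open_ends i i|.
Definition threshold i := #|open_ends i.+1 i|.

Lemma open_endsP k i (e : 'I_n.+1) :
  reflect (i < e /\ exists2 a, a < n & (a < k) /\ next a = e) (e \in open_ends k i).
Proof.
rewrite inE; apply: (iffP andP) => -[ie].
  by case/existsP=> a /andP[ak /eqP ae]; split=> //; exists a.
case=> a an [ak ae]; split=> //; apply/existsP; exists (Ordinal an); by rewrite /= ak ae eqxx.
Qed.

Lemma card_open_ends_out k i : n <= i -> #|open_ends k i| = 0.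
Proof.
move=> ni; apply/eqP; rewrite cards_eq0; apply/eqP/setP=> e; rewrite !inE.
by case: (ltnP i e) => //= ie; have := ltn_ord e; lia.
Qed.

Lemma height_le_threshold i : height i <= threshold i.
Proof.
apply/subset_leq_card/subsetP=> e /open_endsP[ie [a an [ai ae]]]; apply/open_endsP.
by split=> //; exists a => //; split=> //; lia.
Qed.

(** The only end that the interval of [i] can add is [next i]. *)
Lemma threshold_le_height i : threshold i <= (height i).+1.
Proof.
case: (ltnP i n) => [lt_in|ni]; last by rewrite /threshold card_open_ends_out.
have [_ ni] := andP (next_gt lt_in).
have nn : next i < n.+1 by lia.
rewrite -addn1 -(cards1 (Ordinal nn)) -cardsUI.
apply: leq_trans (leq_addr _ _); apply/subset_leq_card/subsetP=> e /open_endsP[ie [a an [ai ae]]].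
rewrite in_setU in_set1; case: (ltngtP a i) => ai'; last 1 first.
- by apply/orP; right; apply/eqP/val_inj; rewrite /= -ai' ae.
- by apply/orP; left; apply/open_endsP; split=> //; exists a.
- by lia.
Qed.

Lemma height_succ_le_threshold i : height i.+1 <= threshold i.
Proof.
apply/subset_leq_card/subsetP=> e /open_endsP[ie [a an [ai ae]]]; apply/open_endsP.
by split=> //; [lia | exists a].
Qed.

(** Moving on from [i] to [i.+1] can lose no end but [i.+1]. *)
Lemma threshold_le_height_succ i : threshold i <= (height i.+1).+1.
Proof.
case: (ltnP i n) => [lt_in|ni]; last by rewrite /threshold card_open_ends_out.
have nn : i.+1 < n.+1 by lia.
rewrite -addn1 -(cards1 (Ordinal nn)) -cardsUI.
apply: leq_trans (leq_addr _ _); apply/subset_leq_card/subsetP=> e /open_endsP[ie [a an [ai ae]]].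
rewrite in_setU in_set1; case: (ltngtP e i.+1) => ei; first lia.
- by apply/orP; left; apply/open_endsP; split=> //; exists a.
- by apply/orP; right; apply/eqP/val_inj.
Qed.

Lemma height_out i : n <= i -> height i = 0.
Proof. exact: card_open_ends_out. Qed.

Lemma height0 : height 0 = 0.
Proof.
by apply/eqP; rewrite cards_eq0; apply/eqP/setP=> e; rewrite !inE andbC; case: existsP => // -[a].
Qed.

(** An end counted in [threshold i] belongs to an interval that starts at or before [i] and, by
    nesting, reaches at least [next i]; so it is still open at [k]. *)
Lemma threshold_le_before i k : i < n -> i < k < next i -> threshold i <= height k.
Proof.
move=> lt_in /andP[ik kn].
apply/subset_leq_card/subsetP=> e /open_endsP[ie [a an [ai ae]]]; apply/open_endsP.
split; last by exists a => //; split=> //; lia.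
suff : next i <= e by lia.
have [ai'|ai'] : a = i \/ a < i by lia.
  by rewrite -ae ai'.
by rewrite -ae; apply: next_noncrossing => //; lia.
Qed.

(** An interval starting strictly between [i] and [next i] ends by [next i], so all ends open at
    [next i] were already counted at [i]. The end [next i] was counted there too, but is no longer
    open. *)
Lemma height_next_lt_threshold i : i < n -> height (next i) < threshold i.
Proof.
move=> lt_in; have /andP[iN Nn] := next_gt lt_in.
have nn : next i < n.+1 by lia.
apply/proper_card/properP; split.
  apply/subsetP=> e /open_endsP[ie [a an [ai ae]]]; apply/open_endsP; split; first lia.
  exists a => //; split=> //; rewrite leqNgt; apply/negP=> ia.
  by have := next_noncrossing an (i := i); lia.
exists (Ordinal nn); first by apply/open_endsP; split=> //; exists i.
by apply/open_endsP => -[]; rewrite ltnn.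
Qed.

End Walk.

(** * Packing digits into one number *)

Section Digits.
Variable base : nat.

Fixpoint pack (s : seq nat) : nat := if s is a :: s' then pack s' * base + a else 0.
Definition digit (x j : nat) : nat := x %/ base ^ j %% base.

Lemma pack_lt s : all (fun a => a < base) s -> pack s < base ^ size s.
Proof. by elim: s => //= a s IH /andP[ab /IH]; rewrite expnS; nia. Qed.

Lemma digit_pack s j : all (fun a => a < base) s -> j < size s -> digit (pack s) j = nth 0 s j.
Proof.
rewrite /digit; elim: s j => //= a s IH j /andP[ab sb]; have b0 : 0 < base by lia.
case: j => [_|j js] /=; first by rewrite expn0 divn1 modnMDl modn_small.
by rewrite expnS divnMA divnMDl // (divn_small ab) addn0 IH.
Qed.

Lemma digit_lt x j : 0 < base -> digit x j < base.
Proof. exact: ltn_pmod. Qed.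

Definition pack_fun k (f : nat -> nat) := pack (mkseq f k).

Lemma pack_fun_lt k f : (forall j, j < k -> f j < base) -> pack_fun k f < base ^ k.
Proof.
move=> fb; rewrite -[k in _ ^ k](size_mkseq f); apply: pack_lt.
by apply/allP=> a /mapP[j]; rewrite mem_iota => jk ->; apply: fb.
Qed.

Lemma digit_pack_fun k f j : (forall j, j < k -> f j < base) -> j < k ->
  digit (pack_fun k f) j = f j.
Proof.
move=> fb jk; rewrite digit_pack ?size_mkseq ?nth_mkseq //.
by apply/allP=> a /mapP[l]; rewrite mem_iota => lk ->; apply: fb.
Qed.

End Digits.

(** * Step functions with few jumps *)

Section StepFunction.
Variable F : nat -> nat.

Definition jump u := (0 < u) && (F u != F u.-1).
Definition rank u := count jump (iota 0 u.+1).

Lemma rankS u : rank u.+1 = rank u + jump u.+1.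
Proof. by rewrite /rank -[u.+2]addn1 iotaD count_cat /= addn0. Qed.

Lemma leq_rank u v : u <= v -> rank u <= rank v.
Proof. by elim: v => [|v IH]; [rewrite leqn0 => /eqP->|rewrite leq_eqVlt => /orP[/eqP->//|/IH]; rewrite rankS; lia]. Qed.

Lemma rank_lip u k : rank (u + k) <= rank u + k.
Proof. by elim: k => [|k IH]; rewrite ?addn0 // addnS rankS; case: jump; lia. Qed.

Lemma eq_rank u v : rank u = rank v -> F u = F v.
Proof.
wlog uv : u v / u <= v => [H|].
  by case: (leqP u v) => [/H//|/ltnW/H + /esym]; move=> /[apply].
elim: v uv => [|v IH]; first by rewrite leqn0 => /eqP->.
rewrite leq_eqVlt ltnS => /orP[/eqP->//|uv E].
have := leq_rank uv; move: (E); rewrite rankS => E1 le.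
have j0 : jump v.+1 = false by case: jump E1 le; lia.
by rewrite IH //; [move: j0; rewrite /jump /= => /negbFE/eqP | rewrite E1 j0 addn0].
Qed.

Variables (N chunk : nat).
Hypothesis chunk_gt0 : 0 < chunk.

(* At most one crowded chunk starts at a given rank, so [detail] can be indexed
   by ranks instead of chunks. *)
Definition crowded c := rank (c * chunk) != rank (c * chunk + chunk.-1).
Definition detail_chunk r := find (fun c => crowded c && (rank (c * chunk) == r)) (iota 0 N).
Definition detail r o := rank (detail_chunk r * chunk + o) - rank (detail_chunk r * chunk).
Definition value_at r := F (find (fun u => rank u == r) (iota 0 (N * chunk))).

Lemma find_iota (p : pred nat) k : p k -> k < N -> (forall j, j < k -> ~~ p j) -> find p (iota 0 N) = k.
Proof.
move=> pk kN hj; have hp : has p (iota 0 N) by apply/hasP; exists k; rewrite ?mem_iota.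
have fN : find p (iota 0 N) < N by rewrite -[X in _ < X](size_iota 0) -has_find.
have := nth_find 0 hp; rewrite nth_iota // add0n => pf.
case: (ltngtP (find p (iota 0 N)) k) => // lt; first by have := hj _ lt; rewrite pf.
by have := before_find 0 lt; rewrite nth_iota // add0n pk.
Qed.

(** The first argument of the same rank stands in for [u], so one stored value per rank suffices. *)
Lemma value_at_rank u : u < N * chunk -> value_at (rank u) = F u.
Proof.
move=> uN; apply: eq_rank; have hs : has (fun v => rank v == rank u) (iota 0 (N * chunk)).
  by apply/hasP; exists u => //; rewrite mem_iota.
by have /eqP := nth_find 0 hs; rewrite nth_iota // -[X in _ < X](size_iota 0) -has_find.
Qed.

(** A crowded chunk has a jump after its first position, so every later chunk starts at a strictly
    larger rank. *)
Lemma detail_crowded c : c < N -> crowded c -> detail_chunk (rank (c * chunk)) = c.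
Proof.
move=> cN cc; apply: find_iota => //; first by rewrite cc eqxx.
move=> j jc; apply/negP=> /andP[cj /eqP E].
have l : j * chunk + chunk.-1 <= c * chunk.
  by have : j.+1 * chunk <= c * chunk by [rewrite leq_mul2r jc orbT]; rewrite mulSn; lia.
have := leq_rank l; have := leq_rank (leq_addr chunk.-1 (j * chunk)).
by move: cj; rewrite /crowded; lia.
Qed.

(** The rank is constant on a chunk that is not crowded, so the flag alone replaces its details. *)
Lemma rank_chunk c o : c < N -> o < chunk ->
  rank (c * chunk + o) = rank (c * chunk) + crowded c * detail (rank (c * chunk)) o.
Proof.
move=> cN oc; have l1 := leq_rank (leq_addr o (c * chunk)).
case: (boolP (crowded c)) => [cc|]; rewrite ?mul1n ?mul0n.
  by rewrite /detail detail_crowded //; lia.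
have l2 : c * chunk + o <= c * chunk + chunk.-1 by lia.
have := leq_rank l2; by rewrite /crowded; lia.
Qed.

Lemma detail_lt r o : o < chunk -> detail r o < chunk.
Proof. by rewrite /detail => oc; have := rank_lip (detail_chunk r * chunk) o; lia. Qed.

End StepFunction.

(** * Compiling expressions to the word RAM *)

Inductive expr :=
  | Var (k : nat)
  | Cst (c : nat)
  | Deref (e : expr)
  | Bin (o : binop) (e1 e2 : expr).

Inductive cmd :=
  | Skip
  | Let (k : nat) (e : expr)
  | Seq (c1 c2 : cmd)
  | IfEq (j k : nat) (c1 c2 : cmd).

(* Registers below [scratch] hold the variables of a [cmd]; the others are used
   as an evaluation stack. *)
Definition scratch := 30.

(** The value ends up in register [r]. [Or] of a register with itself serves as the copy
    instruction. *)
Fixpoint compile_expr (r : nat) (e : expr) : program :=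
  match e with
  | Var k => [:: Op Or r k k]
  | Cst c => [:: Const r c]
  | Deref e1 => rcons (compile_expr r e1) (Read r r)
  | Bin o e1 e2 =>
      rcons (compile_expr r e1 ++ compile_expr r.+1 e2) (Op o r r r.+1)
  end.

(** Jump targets are absolute, hence the start address [p]. In a conditional the code of the second
    branch comes first, and [q] is the address of the other one. *)
Fixpoint compile (p : nat) (c : cmd) : program :=
  match c with
  | Skip => [::]
  | Let k e => rcons (compile_expr scratch e) (Op Or k scratch scratch)
  | Seq c1 c2 => let s := compile p c1 in s ++ compile (p + size s) c2
  | IfEq j k c1 c2 =>
      let s := compile p.+1 c2 in
      let q := p + (size s).+2 in
      let s' := compile q c1 in
      JumpEq j k q :: s ++ Jump (q + size s') :: s'
  end.

Section Semantics.
Variables (w : nat) (M : seq nat).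

(** The side conditions keep constants from wrapping around and confine reads to [M], since the
    memory outside [M] is arbitrary. *)
Inductive eval (rho : nat -> nat) : expr -> nat -> Prop :=
  | eval_var k : k < scratch -> eval rho (Var k) (rho k)
  | eval_cst c : c < 2 ^ w -> eval rho (Cst c) c
  | eval_deref e a : eval rho e a -> a < size M -> eval rho (Deref e) (nth 0 M a)
  | eval_bin o e1 e2 x y : eval rho e1 x -> eval rho e2 y ->
      eval rho (Bin o e1 e2) (eval_binop w o x y).

Inductive run (rho : nat -> nat) : cmd -> (nat -> nat) -> Prop :=
  | run_skip : run rho Skip rho
  | run_let k e x : k < scratch -> eval rho e x -> run rho (Let k e) [eta rho with k |-> x]
  | run_seq c1 c2 rho1 rho2 :
      run rho c1 rho1 -> run rho1 c2 rho2 -> run rho (Seq c1 c2) rho2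
  | run_ifeq j k c1 c2 rho' : j < scratch -> k < scratch ->
      run rho (if rho j == rho k then c1 else c2) rho' -> run rho (IfEq j k c1 c2) rho'.

Lemma run_lete rho k e x rho' c :
  k < scratch -> eval rho e x -> run [eta rho with k |-> x] c rho' -> run rho (Seq (Let k e) c) rho'.
Proof. by move=> ks ev r; apply: run_seq r; apply: run_let. Qed.

Variable P : program.

Definition placed (p : nat) (s : program) := exists s1 s2, P = s1 ++ s ++ s2 /\ size s1 = p.

Lemma placed_catl p s1 s2 : placed p (s1 ++ s2) -> placed p s1.
Proof. by case=> u [v [PE <-]]; exists u, (s2 ++ v); rewrite PE -!catA. Qed.

Lemma placed_catr p s1 s2 : placed p (s1 ++ s2) -> placed (p + size s1) s2.
Proof. by case=> u [v [PE <-]]; exists (u ++ s1), v; rewrite PE size_cat -!catA. Qed.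

Lemma placed_step p i s c : placed p (i :: s) -> pc c = p -> step w P c = exec w i c.
Proof. by case=> u [v [PE <-]] pcE; rewrite /step pcE PE onth_cat ltnn subnn. Qed.

Definition reaches (k : nat) (c c' : config) := exists2 t, t <= k & iter t (step w P) c = c'.

Lemma reaches_trans c2 k1 k2 c1 c3 : reaches k1 c1 c2 -> reaches k2 c2 c3 -> reaches (k1 + k2) c1 c3.
Proof. by move=> [t1 l1 <-] [t2 l2 <-]; exists (t2 + t1); rewrite ?iterD //; lia. Qed.

Lemma reaches_step p i s c : placed p (i :: s) -> pc c = p -> reaches 1 c (exec w i c).
Proof. by move=> /placed_step H /H <-; exists 1. Qed.

(** Registers below [r] must be preserved because a binary operation keeps its left value in [r]
    while the right operand is evaluated from [r.+1] on. *)
Lemma compile_exprP rho e x : eval rho e x -> forall p r c,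
  placed p (compile_expr r e) -> scratch <= r -> pc c = p ->
  (forall j, j < scratch -> reg c j = rho j) -> stores M (Defs.mem c) ->
  exists c', [/\ reaches (size (compile_expr r e)) c c',
    pc c' = p + size (compile_expr r e), reg c' r = x,
    forall j, j < r -> reg c' j = reg c j & Defs.mem c' = Defs.mem c].
Proof.
elim=> {e x} [k ks|a aw|e a _ IH aM|o e1 e2 x y _ IH1 _ IH2] p r c pl rs pcE regE st /=.
- exists (exec w (Op Or r k k) c); split; first exact: reaches_step pl pcE.
  + by case: c pcE {regE st} => pc0 r0 m /= ->; rewrite addn1.
  + by case: c pcE regE {st} => pc0 r0 m /= _ regE; rewrite eqxx regE // PeanoNat.Nat.lor_diag.
  + by case: c {pcE regE st} => pc0 r0 m /= j jr; rewrite (ltn_eqF jr).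
  + by case: c {pcE regE st}.
- exists (exec w (Const r a) c); split; first exact: reaches_step pl pcE.
  + by case: c pcE {regE st} => pc0 r0 m /= ->; rewrite addn1.
  + by case: c {pcE regE st} => pc0 r0 m /=; rewrite eqxx (modn_small aw).
  + by case: c {pcE regE st} => pc0 r0 m /= j jr; rewrite (ltn_eqF jr).
  + by case: c {pcE regE st}.
- rewrite /= -cats1 in pl *.
  have [c1 [re1 pc1 x1 old1 mem1]] := IH p r c (placed_catl pl) rs pcE regE st.
  have pl' := placed_catr pl.
  exists (exec w (Read r r) c1); rewrite size_cat; split.
  + by apply: reaches_trans re1 _; apply: reaches_step pl' pc1.
  + by case: c1 pc1 {re1 x1 old1 mem1} => pc0 r0 m /= ->; rewrite addnA addn1.
  + by case: c1 x1 mem1 {re1 pc1 old1} => pc0 r0 m /= -> ->; rewrite eqxx st.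
  + by case: c1 old1 {re1 pc1 x1 mem1} => pc0 r0 m /= old1 j jr; rewrite (ltn_eqF jr) old1.
  + by case: c1 mem1 {re1 pc1 x1 old1}.
- rewrite /= -cats1 in pl *.
  have [c1 [re1 pc1 x1 old1 mem1]] := IH1 p r c (placed_catl (placed_catl pl)) rs pcE regE st.
  have [|||c2 [re2 pc2 x2 old2 mem2]] := IH2 (p + size (compile_expr r e1)) r.+1 c1
    (placed_catr (placed_catl pl)) _ pc1.
  + exact: leq_trans rs _.
  + by move=> j js; rewrite old1 ?regE //; apply: leq_trans js rs.
  + by rewrite mem1.
  have pl' := placed_catr pl.
  exists (exec w (Op o r r r.+1) c2); rewrite !size_cat; split.
  + apply: reaches_trans (reaches_trans re1 re2) _; apply: reaches_step pl' _.
    by rewrite pc2 size_cat addnA.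
  + by case: c2 pc2 {re2 x2 old2 mem2} => pc0 r0 m /= ->; rewrite !addnA addn1.
  + have := old2 r (ltnSn r); rewrite x1.
    by case: c2 x2 {re2 pc2 old2 mem2} => pc0 r0 m /= -> ->; rewrite eqxx.
  + move=> j jr; have := old2 j (ltnW jr); rewrite old1 //.
    by case: c2 {re2 pc2 x2 old2 mem2} => pc0 r0 m /=; rewrite (ltn_eqF jr).
  + by rewrite -mem1 -mem2; case: c2 {re2 pc2 x2 old2 mem2}.
Qed.

(** All jumps go forward, so the length of the code bounds the number of steps. The code never
    writes to memory. *)
Lemma compileP rho cm rho' : run rho cm rho' -> forall p c,
  placed p (compile p cm) -> pc c = p ->
  (forall j, j < scratch -> reg c j = rho j) -> stores M (Defs.mem c) ->
  exists c', [/\ reaches (size (compile p cm)) c c', pc c' = p + size (compile p cm),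
    forall j, j < scratch -> reg c' j = rho' j & Defs.mem c' = Defs.mem c].
Proof.
elim=> {rho cm rho'} [rho|rho k e x ks ev|rho c1 c2 rho1 rho2 _ IH1 _ IH2|rho j k c1 c2 rho' js ks _ IH]
  p c pl pcE regE st /=.
- by exists c; rewrite addn0; split=> //; exists 0.
- rewrite /= -cats1 in pl *.
  have [c1 [re1 pc1 x1 old1 mem1]] := compile_exprP ev (placed_catl pl) (leqnn _) pcE regE st.
  exists (exec w (Op Or k scratch scratch) c1); rewrite size_cat; split.
  + by apply: reaches_trans re1 _; apply: reaches_step (placed_catr pl) pc1.
  + by case: c1 pc1 {re1 x1 old1 mem1} => pc0 r0 m /= ->; rewrite addnA addn1.
  + case: c1 x1 old1 {re1 pc1 mem1} => pc0 r0 m /= -> old1 i is_.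
    by case: (i == k); rewrite ?PeanoNat.Nat.lor_diag // old1 ?regE.
  + by case: c1 mem1 {re1 pc1 x1 old1}.
- have [d1 [re1 pc1 reg1 mem1]] := IH1 p c (placed_catl pl) pcE regE st.
  have [|d2 [re2 pc2 reg2 mem2]] := IH2 _ d1 (placed_catr pl) pc1 reg1; first by rewrite mem1.
  exists d2; rewrite size_cat addnA; split=> //; [exact: reaches_trans re1 re2|by rewrite mem2].
move: pl => /=; set s := compile p.+1 c2; set q := p + (size s).+2; set s' := compile q c1 => pl.
have re0 := reaches_step pl pcE.
have : exec w (JumpEq j k q) c = Config (if rho j == rho k then q else p.+1) (reg c) (Defs.mem c).
  by case: c regE pcE {st re0} => pc0 r0 m /= regE ->; rewrite !regE.
set c0 := Config _ _ _ => E; rewrite {}E in re0.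
have pl2 : placed p.+1 (s ++ Jump (q + size s') :: s').
  by move: pl; rewrite -cat1s => /placed_catr; rewrite addn1.
case: eqP IH @c0 re0 => _ IH c0 re0.
  have pl1 : placed q s'.
    move: (placed_catr pl2); rewrite -cat1s => /placed_catr /=.
    by rewrite (_ : p.+1 + size s + 1 = q) // /q; lia.
  have [c' [re' pc' reg' mem']] := IH q c0 pl1 erefl regE st.
  exists c'; split=> //; last by rewrite pc' -/s' /= size_cat {1}/q /=; lia.
  have [t tle <-] := reaches_trans re0 re'; exists t => //.
  by apply: leq_trans tle _; rewrite /= size_cat /= -/s'; lia.
have [c' [re' pc' reg' mem']] := IH p.+1 c0 (placed_catl pl2) erefl regE st.
exists (exec w (Jump (q + size s')) c'); split.
- have [t tle <-] := reaches_trans (reaches_trans re0 re') (reaches_step (placed_catr pl2) pc').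
  by exists t => //; apply: leq_trans tle _; rewrite /= size_cat /= -/s; lia.
- by case: c' {re' pc' reg' mem'} => pc0 r0 m /=; rewrite size_cat /q /=; lia.
- by case: c' reg' {re' pc' mem'}.
- by case: c' mem' {re' pc' reg'}.
Qed.

End Semantics.

(** The time bound is the length of the code, which depends neither on the memory nor on the word
    size. *)
Lemma run_answers w cm M x y :
  (forall rho, rho 0 = x -> exists2 rho', run w M rho cm rho' & rho' 0 = y) ->
  answers w (compile 0 cm) (size (compile 0 cm)) M x y.
Proof.
move=> cmP c pc0 reg0 st _ _; have [rho' r y0] := cmP (reg c) reg0.
have pl : placed (compile 0 cm) 0 (compile 0 cm) by exists [::], [::]; rewrite cats0.
have [c' [[t tle tE] pc' reg' mem']] := compileP r pl pc0 (fun j _ => erefl) st.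
(* The run may stop before the full number of steps has elapsed; a halted machine stays put, so it
   can be padded. *)
have halts k : iter (k + t) (step w (compile 0 cm)) c = c'.
  elim: k => [|k IH] //; rewrite addSn iterS IH /step pc' add0n.
  by rewrite onth_default.
rewrite -(subnK tle) halts; split; last by rewrite mem'.
- by rewrite /halted pc'.
- by rewrite reg'.
Qed.

Section EvalRules.
Variables (w : nat) (M : seq nat) (rho : nat -> nat).
Local Notation ev := (eval w M rho).

Lemma eval_varE k x : k < scratch -> rho k = x -> ev (Var k) x.
Proof. by move=> ks <-; constructor. Qed.

Lemma eval_add e1 e2 x y : ev e1 x -> ev e2 y -> x + y < 2 ^ w -> ev (Bin Add e1 e2) (x + y).
Proof. by move=> e1x e2y lt; rewrite -[x + y](modn_small lt); exact: (eval_bin Add e1x e2y). Qed.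

Lemma eval_mul e1 e2 x y : ev e1 x -> ev e2 y -> x * y < 2 ^ w -> ev (Bin Mul e1 e2) (x * y).
Proof. by move=> e1x e2y lt; rewrite -[x * y](modn_small lt); exact: (eval_bin Mul e1x e2y). Qed.

Lemma eval_sub e1 e2 x y : ev e1 x -> ev e2 y -> y <= x -> x < 2 ^ w -> ev (Bin Defs.Sub e1 e2) (x - y).
Proof.
move=> e1x e2y yx lt; suff <- : eval_binop w Defs.Sub x y = x - y by apply: eval_bin.
by rewrite /= -addnBAC // modnDr modn_small //; lia.
Qed.

Lemma eval_div e1 e2 x y : ev e1 x -> ev e2 y -> ev (Bin Div e1 e2) (x %/ y).
Proof. exact: eval_bin. Qed.

Lemma eval_mod e1 e2 x y : ev e1 x -> ev e2 y -> ev (Bin Mod e1 e2) (x %% y).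
Proof. exact: eval_bin. Qed.

Lemma eval_shr e1 e2 x y : ev e1 x -> ev e2 y -> ev (Bin Shr e1 e2) (x %/ 2 ^ y).
Proof. exact: eval_bin. Qed.

End EvalRules.

(** * The data structure *)

Section FirstBelow.
Implicit Types (f : nat -> nat) (t a k r : nat).

(** The value [a + k] means that no position of the range qualifies. *)
Definition first_below f t a k := a + find (fun j => f j < t) (iota a k).

Lemma first_below_le f t a k : a <= first_below f t a k <= a + k.
Proof. by rewrite leq_addr leq_add2l -[X in _ <= X](size_iota a) find_size. Qed.

Lemma first_below_lt f t a k : first_below f t a k < a + k -> f (first_below f t a k) < t.
Proof.
rewrite /first_below ltn_add2l => lt; rewrite -(nth_iota 0 a lt).
have hf : has (fun j => f j < t) (iota a k) by rewrite has_find size_iota.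
exact: (nth_find 0 hf).
Qed.

Lemma before_first_below f t a k j : a <= j < first_below f t a k -> t <= f j.
Proof.
rewrite /first_below => /andP[aj jf]; have lt : j - a < find (fun j => f j < t) (iota a k) by lia.
have := before_find 0 lt; rewrite nth_iota; first by rewrite subnKC // ltnNge => /negbFE.
by apply: leq_trans lt _; rewrite -[X in _ <= X](size_iota a) find_size.
Qed.

Lemma first_belowE f t a k r : a <= r < a + k -> f r < t ->
  (forall j, a <= j < r -> t <= f j) -> first_below f t a k = r.
Proof.
move=> /andP[ar rk] fr hr; have /andP[al lk] := first_below_le f t a k.
case: (ltngtP (first_below f t a k) r) => // lt.
  have := first_below_lt (leq_trans lt (ltnW rk)); have := hr (first_below f t a k).
  by rewrite al lt => /(_ isT); lia.
by have := @before_first_below f t a k r; rewrite ar lt => /(_ isT); lia.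
Qed.

Lemma first_below_none f t a k :
  (forall j, a <= j < a + k -> t <= f j) -> first_below f t a k = a + k.
Proof.
move=> hr; have /andP[al lk] := first_below_le f t a k.
apply/eqP; rewrite eqn_leq lk /= leqNgt; apply/negP=> lt.
by have := first_below_lt lt; have := hr (first_below f t a k); rewrite al lt => /(_ isT); lia.
Qed.

Lemma eq_first_below f f' t t' a k :
  (forall j, a <= j < a + k -> (f j < t) = (f' j < t')) ->
  first_below f t a k = first_below f' t' a k.
Proof.
by move=> e; congr addn; apply: eq_in_find => j; rewrite mem_iota => /e.
Qed.

(** The answer for [t.+1] has a value below [t.+1]; if it differs from the answer for [t], it comes
    earlier, so its value is also at least [t]. *)
Lemma first_below_jump f t a k (r := first_below f t.+1 a k) : r != first_below f t a k ->
  [/\ a <= r, r < a + k, f r = t & forall j, a <= j < r -> t < f j].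
Proof.
have /andP[l1 u1] := first_below_le f t.+1 a k.
have /andP[l2 u2] := first_below_le f t a k; rewrite -/r in l1 u1 * => neq.
have hr j : a <= j < r -> t < f j by move=> hj; apply: before_first_below hj.
have lt : r < first_below f t a k.
  rewrite ltn_neqAle neq leqNgt; apply/negP=> gt.
  have := first_below_lt (leq_trans gt u1); rewrite ltnNge ltnW //.
  by apply: hr; rewrite l2.
have rk := leq_trans lt u2; split=> //; apply/eqP; rewrite eqn_leq.
rewrite -ltnS (first_below_lt rk) /=; apply: (@before_first_below f t a k).
by rewrite l1.
Qed.

Definition min_on f a k := foldr minn (f a) (map f (iota a k)).

Lemma min_on_le f a k j : a <= j < a + k -> min_on f a k <= f j.
Proof.
have min_in x (s : seq nat) y : y \in s -> foldr minn x s <= y.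
  by elim: s => //= z s IH; rewrite in_cons geq_min => /orP[/eqP->|/IH->]; rewrite ?leqnn ?orbT.
by move=> jak; apply: min_in; apply: map_f; rewrite mem_iota.
Qed.

Lemma min_on_attained f a k : 0 < k -> exists2 j, a <= j < a + k & min_on f a k = f j.
Proof.
have min_ex x (s : seq nat) : foldr minn x s \in x :: s.
  elim: s => [|y s IH] /=; first by rewrite mem_head.
  by rewrite /minn; case: ifP => _; [|move: IH]; rewrite !in_cons ?eqxx ?orbT // => /orP[->|->]; rewrite ?orbT.
move=> k0; have := min_ex (f a) (map f (iota a k)); rewrite in_cons => /orP[/eqP E|].
  by exists a => //; lia.
by case/mapP=> j; rewrite mem_iota; exists j.
Qed.

End FirstBelow.

(** * The walk cut into micro-blocks and blocks *)

Section Structure.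
Variables (n : nat) (V h : nat -> nat).
Hypothesis V_le_h : forall i, V i <= h i.
Hypothesis h_le_V : forall i, h i <= (V i).+1.
Hypothesis VS_le_h : forall i, V i.+1 <= h i.
Hypothesis h_le_VS : forall i, h i <= (V i.+1).+1.
Hypothesis V0 : V 0 = 0.
Hypothesis V_out : forall i, n <= i -> V i = 0.

Lemma V_le_add a k : V (a + k) <= V a + k.
Proof. by elim: k => [|k IH]; rewrite ?addn0 // !addnS; have := VS_le_h (a + k); have := h_le_V (a + k); lia. Qed.

Lemma V_add_ge a k : V a <= V (a + k) + k.
Proof. by elim: k => [|k IH]; rewrite ?addn0 // !addnS; have := h_le_VS (a + k); have := V_le_h (a + k); lia. Qed.

(** The walk starts at 0, is back at 0 at position [n], and moves by at most one per position. *)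
Lemma double_V_le i : 2 * V i <= n.
Proof.
case: (leqP n i) => [/V_out->//|lt_in].
have := V_le_add 0 i; rewrite V0 !add0n.
by have := V_add_ge i (n - i); rewrite subnKC ?(ltnW lt_in) // (V_out (leqnn n)); lia.
Qed.

Definition is_next i e := [/\ i < e, V e < h i & forall k, i < k < e -> h i <= V k].

Section Next.
Variables (i e : nat).
Hypothesis (next_e : is_next i e) (lt_in : i < n).

Lemma is_next_le : e <= n.
Proof.
have [ie eh hk] := next_e; rewrite leqNgt; apply/negP=> ne.
by have := hk n; rewrite lt_in ne V_out // => /(_ isT); lia.
Qed.

(** Strictly between [i] and [e] the walk stays at or above [h i], and the step into [e] lowers it
    by at most one. *)
Lemma threshold_le_until k : i < k <= e -> h i <= (V k).+1.
Proof.
have [ie eh hk] := next_e => /andP[ik ke]; case: (ltnP k e) => [lt|ge].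
  by apply/leqW/hk; rewrite ik.
have -> : k = e by lia.
case: (ltnP i e.-1) => ie'; last by have <- : i.+1 = e by lia.
have := hk e.-1; rewrite ie' => /(_ ltac:(lia)) le1; apply: leq_trans le1 _.
by have := V_add_ge e.-1 1; rewrite addn1 addn1 prednK //; lia.
Qed.

End Next.

(* [b] positions form a micro-block and [f] micro-blocks form a block. *)
Variables (b f : nat).
Hypotheses (b_gt0 : 0 < b) (f_gt0 : 0 < f).
Definition block_len := f * b.
Definition num_blocks := (n %/ block_len).+1.
Local Notation B := block_len.
Local Notation NX := num_blocks.
(** Heights relative to the start of a block, shifted by [B], range from 0 to [2 * B]; [m] is their
    number and serves as the base of their encoding. *)
Local Notation m := (2 * B).+1.

Lemma block_len_gt0 : 0 < B. Proof. by rewrite muln_gt0 f_gt0. Qed.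

(** The high bit tells whether the walk rises from [V i] to [h i], the low bit whether it then falls
    from [h i] to [V i.+1]. *)
Definition step_code i := 2 * (h i - V i) + (h i - V i.+1).
Definition micro_code x := pack_fun 4 b (fun j => step_code (x * b + j)).

Definition ups z j := \sum_(l < j) digit 4 z l %/ 2.
Definition downs z j := \sum_(l < j) digit 4 z l %% 2.
(* Relative heights are shifted by the length of their unit, [b] or [B], so that
   they are natural numbers. *)
Definition rel_height z j := b + ups z j - downs z j.
Definition rel_threshold z j := rel_height z j + digit 4 z j %/ 2.

Lemma step_code_lt i : step_code i < 4.
Proof. by rewrite /step_code; have := h_le_V i; have := h_le_VS i; lia. Qed.

Lemma digit_micro_code x j : j < b -> digit 4 (micro_code x) j = step_code (x * b + j).
Proof. by move=> jb; rewrite digit_pack_fun // => l _; apply: step_code_lt. Qed.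

Lemma downs_le z j : downs z j <= j.
Proof.
rewrite -[X in _ <= X](card_ord j) -sum1_card; apply: leq_sum => l _.
by rewrite -ltnS ltn_mod.
Qed.

Lemma ups_le z j : ups z j <= j.
Proof.
rewrite -[X in _ <= X](card_ord j) -sum1_card; apply: leq_sum => l _.
by rewrite -ltnS ltn_divLR //; apply: digit_lt.
Qed.

Lemma rel_heightE x j : j <= b -> rel_height (micro_code x) j + V (x * b) = V (x * b + j) + b.
Proof.
move=> jb; suff : V (x * b) + ups (micro_code x) j = V (x * b + j) + downs (micro_code x) j.
  by rewrite /rel_height; have := downs_le (micro_code x) j; lia.
elim: j jb => [|j IH] jb; first by rewrite addn0 /ups /downs !big_ord0.
have := IH (ltnW jb); rewrite /ups /downs !big_ord_recr /= digit_micro_code // addnS /step_code.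
have := h_le_V (x * b + j); have := h_le_VS (x * b + j).
by have := V_le_h (x * b + j); have := VS_le_h (x * b + j); lia.
Qed.

Lemma rel_thresholdE x j : j < b -> rel_threshold (micro_code x) j + V (x * b) = h (x * b + j) + b.
Proof.
move=> jb; have := rel_heightE x (ltnW jb); rewrite /rel_threshold digit_micro_code // /step_code.
have := h_le_V (x * b + j); have := h_le_VS (x * b + j).
by have := V_le_h (x * b + j); have := VS_le_h (x * b + j); lia.
Qed.

(* 0 says that the answer lies outside the micro-block. *)
Definition near_entry z o :=
  let k := first_below (rel_height z) (rel_threshold z o) o.+1 (b - o.+1) in
  if k < b then k - o else 0.
Definition offset_entry z t := first_below (rel_height z) t 0 b.

Definition micro_min x := min_on V (x * b) b.
Definition block_min X := min_on V (X * B) B.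

(** Start height and minimum of a micro-block form a pair in base [m], so that a whole block becomes
    one number below [(m * m) ^ f], which can index a table. *)
Definition class_digit X j :=
  (V ((X * f + j) * b) + B - V (X * B)) * m + (micro_min (X * f + j) + B - V (X * B)).
Definition block_class X := pack_fun (m * m) f (class_digit X).
Definition start_entry c j := digit (m * m) c j %/ m.
Definition micro_entry c j t := first_below (fun y => digit (m * m) c y %% m) t j (f - j).

Lemma block_bounds X k : k < B -> V (X * B + k) <= V (X * B) + B /\ V (X * B) < V (X * B + k) + B.
Proof. by move=> kB; have := V_le_add (X * B) k; have := V_add_ge (X * B) k; lia. Qed.

Lemma micro_in_block X j : j < f -> exists2 k, k < B & (X * f + j) * b = X * B + k.
Proof. by move=> jf; exists (j * b); [rewrite ltn_mul2r b_gt0 | rewrite mulnDl mulnA]. Qed.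

Lemma micro_min_bounds X j : j < f ->
  micro_min (X * f + j) <= V (X * B) + B /\ V (X * B) < micro_min (X * f + j) + B.
Proof.
rewrite /micro_min => jf; have [k /andP[lk uk] ->] := min_on_attained V ((X * f + j) * b) b_gt0.
have -> : k = X * B + (k - X * B) by have : X * B <= k by [rewrite /B; nia]; lia.
by apply: block_bounds; rewrite /block_len; nia.
Qed.

Lemma start_bounds X j : j < f ->
  V ((X * f + j) * b) <= V (X * B) + B /\ V (X * B) < V ((X * f + j) * b) + B.
Proof. by case/(micro_in_block X)=> k kB ->; apply: block_bounds. Qed.

Lemma class_digit_lt X j : j < f -> class_digit X j < m * m.
Proof.
move=> jf; have [s1 s2] := start_bounds X jf; have [m1 m2] := micro_min_bounds X jf.
rewrite /class_digit; set a := V _ + B - _; set c := micro_min _ + B - _.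
have : a < m by lia. have : c < m by lia.
by move: a c m => a c k; nia.
Qed.

Lemma block_class_lt X : block_class X < (m * m) ^ f.
Proof. by apply: pack_fun_lt => j; apply: class_digit_lt. Qed.

Lemma start_entryE X j : j < f ->
  start_entry (block_class X) j + V (X * B) = V ((X * f + j) * b) + B.
Proof.
move=> jf; rewrite /start_entry digit_pack_fun //; last by move=> l; apply: class_digit_lt.
have [s1 s2] := start_bounds X jf; have [m1 m2] := micro_min_bounds X jf.
by rewrite /class_digit divnMDl // divn_small ?addn0; lia.
Qed.

Lemma micro_entryE X j t s : j <= f -> t + V (X * B) = s + B ->
  micro_entry (block_class X) j t = first_below (fun y => micro_min (X * f + y)) s j (f - j).
Proof.
move=> jf ts; apply: eq_first_below => y /andP[_]; rewrite subnKC // => yf.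
rewrite digit_pack_fun //; last by move=> l; apply: class_digit_lt.
have [m1 m2] := micro_min_bounds X yf.
by rewrite /class_digit modnMDl modn_small; lia.
Qed.

Variables (chunk nc : nat).
Hypotheses (chunk_gt0 : 0 < chunk) (m_le : m <= nc * chunk).
(** The thresholds of a block are padded to a whole number of chunks, so that no chunk straddles two
    blocks. *)
Local Notation span := (nc * chunk).

(* The argument encodes a block and a relative threshold.  Raising the threshold
   to [block_min X] changes nothing for the positions of [X] and removes the
   jumps that could not be charged below. *)
Definition far_block u :=
  let X := u %/ span in
  first_below block_min (maxn (V (X * B) + u %% span - B) (block_min X)) X.+1 (NX - X.+1).

Lemma span_gt0 : 0 < span. Proof. exact: leq_trans m_le. Qed.

Lemma far_block_jump u : u < NX * span -> 0 < u %% span -> jump far_block u ->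
  let X := u %/ span in let Y := far_block u in
  [/\ X < Y, Y < NX, block_min X <= block_min Y, forall Z, X < Z < Y -> block_min Y < block_min Z
    & (block_min Y).+1 + B = V (X * B) + u %% span].
Proof.
move=> uN d0 /andP[u0 neq] X Y.
have XN : X < NX by rewrite /X ltn_divLR ?span_gt0.
have [X1 d1] : u.-1 %/ span = X /\ u.-1 %% span = (u %% span).-1.
  have := divn_eq u span; rewrite -/X => uE; have := ltn_pmod u span_gt0 => dlt.
  have -> : u.-1 = X * span + (u %% span).-1 by lia.
  have lt1 : (u %% span).-1 < span by lia.
  by rewrite divnMDl ?span_gt0 // modnMDl (divn_small lt1) (modn_small lt1) addn0.
have YE : Y = first_below block_min (maxn (V (X * B) + u %% span - B) (block_min X)) X.+1 (NX - X.+1) by [].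
have Y1E : far_block u.-1 =
    first_below block_min (maxn (V (X * B) + (u %% span).-1 - B) (block_min X)) X.+1 (NX - X.+1).
  by rewrite /far_block X1 d1.
set t := V (X * B) + _ - B in YE; set t' := V (X * B) + _ - B in Y1E.
(* A changed answer requires a changed threshold. This excludes both truncation at 0 and clamping at
   [block_min X], so the threshold grows by exactly one. *)
have shift p : maxn t p != maxn t' p ->
    [/\ maxn t p = (maxn t' p).+1, p <= maxn t' p & (maxn t' p).+1 + B = V (X * B) + u %% span].
  rewrite /t /t'; move: d0; move: (V (X * B)) (u %% span) B; clear=> a k q k0 neq; split; lia.
have [|tE tp tB] := shift (block_min X).
  by apply: contraNneq neq => E; rewrite -/Y Y1E YE E.
move: neq; rewrite -/Y Y1E YE tE => /first_below_jump[l1 l2 l3 l4].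
rewrite l3; split=> //; first by move: l2; rewrite subnKC.
Qed.

(* A jump inside the range of a block [X] is charged to the block [Y] it jumps
   to: [X] is the last block before [Y] whose minimum does not exceed that of
   [Y].  The jumps between two ranges are charged to the ranges themselves. *)
Lemma rank_far_block u : u < NX * span -> rank far_block u <= 2 * NX.
Proof.
move=> uN; rewrite /rank -size_filter.
set s := [seq v <- _ | _].
(* Names below [NX] stand for target blocks, names from [NX] on for ranges; it remains to show that
   [charge] is injective on the jumps. *)
pose charge v := if v %% span == 0 then NX + v %/ span else far_block v.
have sP v : v \in s -> v < NX * span /\ jump far_block v.
  by rewrite mem_filter mem_iota => /andP[vj lt]; split=> //; apply: leq_ltn_trans uN.
rewrite -(size_map charge) -(size_iota 0 (2 * NX)); apply: uniq_leq_size.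
  rewrite map_inj_in_uniq ?filter_uniq ?iota_uniq // => v v' /sP[vN vj] /sP[vN' vj'].
  have Xv : v %/ span < NX by rewrite ltn_divLR ?span_gt0.
  have Xv' : v' %/ span < NX by rewrite ltn_divLR ?span_gt0.
  rewrite /charge; case: posnP => d; case: posnP => d' E.
  - by rewrite (divn_eq v span) (divn_eq v' span) d d'; congr (_ * _ + _); lia.
  - by have [] := far_block_jump vN' d' vj'; lia.
  - by have [] := far_block_jump vN d vj; lia.
  have [l1 l2 l3 l4 l5] := far_block_jump vN d vj.
  have [l1' l2' l3' l4' l5'] := far_block_jump vN' d' vj'.
  rewrite -E in l1' l2' l3' l4' l5'.
  (* Of two different sources with the same target, the later one would lie between the earlier one
     and the target, so its minimum would exceed that of the target. *)
  have XX : v %/ span = v' %/ span.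
    case: (ltngtP (v %/ span) (v' %/ span)) => // lt.
      by have := l4 (v' %/ span); rewrite lt l1' => /(_ isT); lia.
    by have := l4' (v %/ span); rewrite lt l1 => /(_ isT); lia.
  rewrite (divn_eq v span) (divn_eq v' span) XX; congr (_ + _).
  by rewrite XX in l5; lia.
move=> _ /mapP[v /sP[vN vj] ->]; rewrite mem_iota /charge.
case: posnP => d; last by have [] := far_block_jump vN d vj; lia.
have : v %/ span < NX by rewrite ltn_divLR ?span_gt0.
by move: (v %/ span) NX => k N; lia.
Qed.

(** * What each table returns on the way from [i] to [e] *)

Section Query.
Variables (i e : nat).
Hypothesis (next_e : is_next i e) (lt_in : i < n).

Lemma near_entryE : near_entry (micro_code (i %/ b)) (i %% b) =
  if e %/ b == i %/ b then e - i else 0.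
Proof.
have [ie eh hk] := next_e; have iE := divn_eq i b; have ob := ltn_pmod i b_gt0.
move: (i %/ b) (i %% b) iE ob => x o iE ob.
have rt := rel_thresholdE x ob.
have below j : j <= b -> (rel_height (micro_code x) j < rel_threshold (micro_code x) o) =
    (V (x * b + j) < h i).
  by move=> jb; have := rel_heightE x jb; rewrite iE in rt *; lia.
have exb : (e %/ b == x) = (e < x.+1 * b).
  rewrite eqn_leq leq_divRL // -ltnS ltn_divLR // andbC.
  by case: leqP => //; rewrite mulSn; lia.
rewrite /near_entry exb mulSn; case: (ltnP e (b + x * b)) => eb.
  have -> : first_below (rel_height (micro_code x)) (rel_threshold (micro_code x) o) o.+1 (b - o.+1) = e - x * b.
    apply: first_belowE; first lia.
      by rewrite below; [rewrite subnKC //; lia|lia].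
    move=> j /andP[oj je]; rewrite leqNgt below; last lia.
    by rewrite -leqNgt hk //; lia.
  by rewrite ifT; lia.
rewrite first_below_none ?ifF //; first lia.
move=> j /andP[oj je]; rewrite leqNgt below; last lia.
by rewrite -leqNgt hk //; lia.
Qed.

Local Notation x' := (e %/ b).
Local Notation X' := (x' %/ f).
Local Notation X := (i %/ b %/ f).

(** With [before_target_min], this makes the micro-block of [e] the first one after that of [i]
    whose minimum is below [h i]. The same pair of facts follows for blocks. *)
Lemma target_min : micro_min x' < h i.
Proof.
have [ie eh hk] := next_e; apply: leq_ltn_trans eh; apply: min_on_le.
by rewrite leq_trunc_div -[X in _ < _ + X]mul1n -mulnDl addn1 ltn_ceil.
Qed.

Lemma before_target_min z : i %/ b < z < x' -> h i <= micro_min z.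
Proof.
have [ie eh hk] := next_e => /andP[iz ze].
have [k /andP[zk kz] kE] := min_on_attained V (z * b) b_gt0; rewrite /micro_min kE; apply: hk.
move: iz ze; rewrite ltn_divLR // leq_divRL // => iz ze.
by rewrite (leq_trans iz zk) (leq_trans kz _) // -[X in _ + X]mul1n -mulnDl addn1.
Qed.

Lemma target_block_min : block_min X' < h i.
Proof.
have [ie eh hk] := next_e; apply: leq_ltn_trans eh; apply: min_on_le.
by rewrite -divnMA [b * f]mulnC -/B leq_trunc_div -[X in _ < _ + X]mul1n -mulnDl addn1
   ltn_ceil ?block_len_gt0.
Qed.

Lemma before_target_block_min Z : X < Z < X' -> h i <= block_min Z.
Proof.
have [ie eh hk] := next_e => /andP[iz ze].
have [k /andP[zk kz] kE] := min_on_attained V (Z * B) block_len_gt0; rewrite /block_min kE; apply: hk.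
move: iz ze; rewrite -!divnMA [b * f]mulnC -/B ltn_divLR ?block_len_gt0 //.
rewrite leq_divRL ?block_len_gt0 // => iz ze.
by rewrite (leq_trans iz zk) (leq_trans kz _) // -[X in _ + X]mul1n -mulnDl addn1.
Qed.

Lemma leq_target_micro : i %/ b <= x'.
Proof. by have [ie _ _] := next_e; apply/leq_div2r/ltnW. Qed.

Lemma leq_target_block : X <= X'.
Proof. exact/leq_div2r/leq_target_micro. Qed.

Lemma target_block_lt : X' < NX.
Proof.
rewrite -divnMA [b * f]mulnC -/B ltnS; apply: leq_div2r; exact: is_next_le next_e lt_in.
Qed.

Lemma source_block_lt : X < NX.
Proof. exact: leq_ltn_trans leq_target_block target_block_lt. Qed.

(** The threshold relative to the source block thus lies between 0 and [2 * B], as the tables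
    require. *)
Lemma source_threshold : V (X * B) <= h i + B /\ h i <= V (X * B) + B.
Proof.
have := divn_eq i B; have := ltn_pmod i block_len_gt0; rewrite -divnMA [b * f]mulnC -/B => lt E.
have := V_le_add (i %/ B * B) (i %% B); have := V_add_ge (i %/ B * B) (i %% B); rewrite -E.
by have := V_le_h i; have := h_le_V i; lia.
Qed.

(** The target block starts after [i] and not after [e], where the walk is at least [h i] minus one;
    hence the threshold relative to that block stays below [m]. *)
Lemma target_threshold : X < X' -> V (X' * B) <= h i + B /\ h i <= (V (X' * B)).+1.
Proof.
have [ie eh hk] := next_e.
have := divn_eq e B; have := ltn_pmod e block_len_gt0; rewrite -!divnMA ![b * f]mulnC -/B => lt E XX.
split; first by have := V_add_ge (e %/ B * B) (e %% B); rewrite -E; lia.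
by apply: (threshold_le_until next_e lt_in); rewrite -ltn_divLR ?block_len_gt0 // XX leq_trunc_div.
Qed.

Lemma target_micro_threshold : i %/ b < x' -> V (x' * b) <= h i + b /\ h i <= (V (x' * b)).+1.
Proof.
have [ie eh hk] := next_e.
have := divn_eq e b; have := ltn_pmod e b_gt0 => lt E xx.
split; first by have := V_add_ge (e %/ b * b) (e %% b); rewrite -E; lia.
by apply: (threshold_le_until next_e lt_in); rewrite -ltn_divLR // xx leq_trunc_div.
Qed.

Lemma offset_entryE t : i %/ b < x' -> t + V (x' * b) = h i + b ->
  offset_entry (micro_code x') t = e %% b.
Proof.
have [ie eh hk] := next_e => xx tE.
have E := divn_eq e b; have lt := ltn_pmod e b_gt0.
apply: first_belowE => //.
  by have := rel_heightE x' (ltnW lt); rewrite -E; lia.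
move=> j /andP[_ je]; have := rel_heightE x' (ltnW (ltn_trans je lt)).
have xi : i < x' * b by rewrite -ltn_divLR.
have : h i <= V (x' * b + j) by apply: hk; rewrite (ltn_addr _ xi) /= [X in _ < X]E ltn_add2l.
by move: (V (x' * b + j)) (V (x' * b)) tE; lia.
Qed.

Lemma micro_entry_same t : i %/ b < x' -> X = X' -> t + V (X * B) = h i + B ->
  micro_entry (block_class X) ((i %/ b) %% f).+1 t = x' %% f.
Proof.
move=> xx XX tE; have lt := ltn_pmod (i %/ b) f_gt0; have lt' := ltn_pmod x' f_gt0.
have E := divn_eq (i %/ b) f; have E' := divn_eq x' f.
rewrite (micro_entryE (s := h i)) //; apply: first_belowE.
- by move: XX E E' xx lt lt'; move: X X' => a a' <-; lia.
- by rewrite XX -E' target_min.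
move=> j /andP[ij jx]; apply: before_target_min; move: ij jx; rewrite -XX in E'.
by move: E E'; move: (X * f) => a; lia.
Qed.

Lemma micro_entry_none t : X < X' -> t + V (X * B) = h i + B ->
  micro_entry (block_class X) ((i %/ b) %% f).+1 t = f.
Proof.
move=> XX tE; have lt := ltn_pmod (i %/ b) f_gt0.
have E := divn_eq (i %/ b) f; have E' := divn_eq x' f.
rewrite (micro_entryE (s := h i)) // first_below_none; first by rewrite subnKC.
move=> j /andP[ij jx]; apply: before_target_min.
have : X.+1 * f <= X' * f by rewrite leq_mul2r XX orbT.
by rewrite mulSn; move: E E' XX; move: (X * f) (X' * f) => a a'; lia.
Qed.

Lemma far_blockE u : X < X' -> u < m -> u + V (X * B) = h i + B ->
  far_block (X * span + u) = X'.
Proof.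
move=> XX um uE; have us : u < span by apply: leq_trans m_le.
rewrite /far_block divnMDl ?span_gt0 // (divn_small us) addn0 modnMDl (modn_small us).
(* Clamping leaves the threshold as it is: the minimum of the source block is at most [V i], hence
   at most [h i]. *)
have -> : maxn (V (X * B) + u - B) (block_min X) = h i.
  have -> : V (X * B) + u - B = h i by lia.
  apply/maxn_idPl; apply: leq_trans (V_le_h i); apply: min_on_le.
  by rewrite -divnMA [b * f]mulnC -/B leq_trunc_div -[X in _ < _ + X]mul1n -mulnDl addn1
    ltn_ceil ?block_len_gt0.
have := target_block_lt => XN; apply: first_belowE; first lia.
  exact: target_block_min.
by move=> Z ZX; apply: before_target_block_min.
Qed.

Lemma micro_entry_far t : X < X' -> t + V (X' * B) = h i + B ->
  micro_entry (block_class X') 0 t = x' %% f.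
Proof.
move=> XX tE; have lt' := ltn_pmod x' f_gt0.
have E := divn_eq (i %/ b) f; have E' := divn_eq x' f; have lt := ltn_pmod (i %/ b) f_gt0.
rewrite (micro_entryE (s := h i)) // subn0; apply: first_belowE => //.
  by rewrite -E' target_min.
move=> j /andP[_ jx]; apply: before_target_min.
have : X.+1 * f <= X' * f by rewrite leq_mul2r XX orbT.
by rewrite mulSn; move: E E'; move: (X * f) (X' * f) => a a'; lia.
Qed.

End Query.

(** * Memory layout and evaluation of its accesses *)

Variables (W c0 g : nat).
Hypotheses (c0_gt1 : 1 < c0) (chunk_gt1 : 1 < chunk).
Hypotheses (codes_fit : 2 * b * c0 <= W) (chunk_fits : g * chunk <= W) (fields_fit : g * nc <= W).
Hypotheses (field_fits : 2 * span + 2 <= 2 ^ g) (n_fits : n < 2 ^ W).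

Definition code_word k := pack_fun (2 ^ (2 * b)) c0 (fun j => micro_code (k * c0 + j)).
Definition base_rank X := rank far_block (X * span).
(** The low bit is the crowded flag. The rank is stored relative to the start of the range of [X],
    where it grows by at most [span], so [g] bits are enough. *)
Definition chunk_field X c :=
  2 * (rank far_block ((X * nc + c) * chunk) - base_rank X) + crowded far_block chunk (X * nc + c).
Definition chunk_word X := pack_fun (2 ^ g) nc (chunk_field X).
Definition detail_word r := pack_fun (2 ^ g) chunk (detail far_block (NX * nc) chunk r).

(** Arrays 0 to 6 describe the walk, and the first of them carries the two bits per position. Arrays
    7 to 11 are tables that depend on the parameters only. Arrays 5 and 6 are indexed by ranks,
    which are at most [2 * NX]. *)
Definition arrays : seq (seq nat) :=
  [:: mkseq code_word (NX * f %/ c0).+1;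
      mkseq block_class NX;
      mkseq (fun X => V (X * B)) NX;
      mkseq base_rank NX;
      mkseq chunk_word NX;
      mkseq detail_word (2 * NX).+1;
      mkseq (value_at far_block (NX * nc) chunk) (2 * NX).+1;
      mkseq (fun k => near_entry (k %/ b) (k %% b)) (2 ^ (2 * b) * b);
      mkseq (fun k => rel_threshold (k %/ b) (k %% b)) (2 ^ (2 * b) * b);
      mkseq (fun k => start_entry (k %/ f) (k %% f)) ((m * m) ^ f * f);
      mkseq (fun k => micro_entry (k %/ m %/ f.+1) (k %/ m %% f.+1) (k %% m)) ((m * m) ^ f * f.+1 * m);
      mkseq (fun k => offset_entry (k %/ (2 * b).+1) (k %% (2 * b).+1)) (2 ^ (2 * b) * (2 * b).+1)].

(** The header has 24 cells: a flag, 12 addresses and 11 parameters. *)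
Definition array_base k := 24 + sumn (take k (shape arrays)).
(* Cell [j.+1] of the header is the address of array [j]; [parameters] start at
   cell 13. *)
Definition parameters :=
  [:: b; f; c0; 2 * b; 2 ^ (2 * b); m; f.+1; chunk; g; 2 ^ g; (2 * b).+1].
Definition header := 1 :: mkseq array_base 12 ++ parameters.
Definition memory := header ++ flatten arrays.

Hypothesis memory_fits : size memory < 2 ^ W.

Lemma size_header : size header = 24. Proof. by []. Qed.

Lemma nth_memory k j : k < 12 -> j < size (nth [::] arrays k) ->
  array_base k + j < size memory /\ nth 0 memory (array_base k + j) = nth 0 (nth [::] arrays k) j.
Proof.
move=> k12 jk; rewrite /memory size_cat nth_cat size_header /array_base -addnA ltn_add2l.
have no_lt a c : (a + c < a) = false by rewrite ltnNge leq_addr.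
rewrite no_lt addKn.
have gen (ss : seq (seq nat)) : k < size ss -> j < size (nth [::] ss k) ->
    sumn (take k (shape ss)) + j < size (flatten ss) /\
    nth 0 (flatten ss) (sumn (take k (shape ss)) + j) = nth 0 (nth [::] ss k) j.
  elim: ss k {k12 jk} => // s ss IH [|k] /= kss js.
    by rewrite size_cat nth_cat js; split=> //; apply: ltn_addr.
  have [l E] := IH k kss js; rewrite size_cat nth_cat -addnA ltn_add2l; split=> //.
  by rewrite no_lt addKn.
by apply: gen.
Qed.

Lemma mul_add_lt a c N k : a < N -> c < k -> a * k + c < N * k.
Proof.
move=> aN ck; apply: (@leq_trans (a.+1 * k)); first by rewrite mulSn addnC ltn_add2r.
by rewrite leq_mul2r aN orbT.
Qed.

Section Evaluation.
Variable rho : nat -> nat.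
Local Notation ev := (eval W memory rho).

Definition param k := Deref (Cst k).
Definition fetch j e := Deref (Bin Add (param j.+1) e).
Definition code_at e :=
  Bin Mod (Bin Shr (fetch 0 (Bin Div e (param 15))) (Bin Mul (Bin Mod e (param 15)) (param 16)))
    (param 17).

Lemma eval_small c : c < 24 -> ev (Cst c) c.
Proof.
move=> c26; constructor; apply: leq_trans memory_fits; apply: leq_trans c26 _.
by rewrite /memory size_cat size_header leqW // leq_addr.
Qed.

Lemma eval_param k : k < 24 -> ev (param k) (nth 0 header k).
Proof.
move=> k26; have k_in : k < size memory by rewrite size_cat size_header; apply: ltn_addr.
by have := eval_deref (eval_small k26) k_in; rewrite nth_cat size_header k26.
Qed.

Lemma eval_fetch j e x : j < 12 -> ev e x -> x < size (nth [::] arrays j) ->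
  ev (fetch j e) (nth 0 (nth [::] arrays j) x).
Proof.
move=> j12 ex xj; have [lt <-] := nth_memory j12 xj.
apply: eval_deref (lt); apply: eval_add (ex) _; last exact: ltn_trans lt memory_fits.
have -> : array_base j = nth 0 header j.+1.
  by rewrite (_ : nth _ _ _ = nth 0 (mkseq array_base 12 ++ parameters) j) // nth_cat size_mkseq j12 nth_mkseq.
by apply: eval_param; apply: leq_trans (_ : 13 <= 24).
Qed.

Lemma eval_fetch_fun j e x F N : j < 12 -> nth [::] arrays j = mkseq F N -> ev e x -> x < N ->
  ev (fetch j e) (F x).
Proof.
move=> j12 jE ex xN; rewrite -(nth_mkseq 0 F xN) -jE; apply: eval_fetch => //.
by rewrite jE size_mkseq.
Qed.

(** The usual way to exclude overflow below: a number not exceeding the size of some array is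
    smaller than the memory, hence a word. *)
Lemma size_array_le j x : j < 12 -> x <= size (nth [::] arrays j) -> x < 2 ^ W.
Proof.
move=> j12; case: x => [|x] xj; first by rewrite expn_gt0.
by have [lt _] := nth_memory j12 xj; apply: leq_ltn_trans memory_fits; apply: leq_trans lt; lia.
Qed.

Lemma eval_fetch2 j e e1 k F N K x y : j < 12 -> k < 24 ->
  nth [::] arrays j = mkseq F (N * K) -> nth 0 header k = K -> ev e x -> ev e1 y ->
  x < N -> y < K -> ev (fetch j (Bin Add (Bin Mul e (param k)) e1)) (F (x * K + y)).
Proof.
move=> j12 k26 jE kE ex ey xN yK; have lt : x * K + y < N * K by apply: mul_add_lt.
have fits : x * K + y < 2 ^ W.
  by apply: (size_array_le j12); rewrite jE size_mkseq ltnW.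
apply: eval_fetch_fun jE _ lt => //; apply: eval_add ey (fits).
by apply: eval_mul => //; [rewrite -kE; apply: eval_param | apply: leq_ltn_trans fits; apply: leq_addr].
Qed.

Lemma micro_code_lt x : micro_code x < 2 ^ (2 * b).
Proof. by rewrite expnM; apply: pack_fun_lt => j _; apply: step_code_lt. Qed.

Lemma digitE k s x : digit (2 ^ k) x s = x %/ 2 ^ (s * k) %% 2 ^ k.
Proof. by rewrite /digit -expnM mulnC. Qed.

Lemma eval_code_at e x : ev e x -> x < NX * f -> ev (code_at e) (micro_code x).
Proof.
move=> ex xN; have c0_gt0 : 0 < c0 by exact: ltnW.
have ec := eval_div ex (eval_param (isT : 15 < 24)); rewrite [nth _ _ _]/= in ec.
have em := eval_mod ex (eval_param (isT : 15 < 24)); rewrite [nth _ _ _]/= in em.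
have lt := ltn_pmod x c0_gt0.
have fits : x %% c0 * (2 * b) < 2 ^ W.
  by apply: leq_ltn_trans (ltn_expl W (ltnSn 1)); apply: leq_trans codes_fit; rewrite mulnC leq_mul2l ltnW ?orbT.
have es := eval_mul em (eval_param (isT : 16 < 24)) fits.
have ew : ev (fetch 0 (Bin Div e (param 15))) (code_word (x %/ c0)).
    apply: (@eval_fetch_fun 0 _ _ code_word (NX * f %/ c0).+1) => //.
  by rewrite ltnS; apply/leq_div2r/ltnW.
have := eval_mod (eval_shr ew es) (eval_param (isT : 17 < 24)); rewrite [nth _ _ _]/= -digitE.
rewrite digit_pack_fun // => [|j _]; last exact: micro_code_lt.
by rewrite -divn_eq.
Qed.

Lemma class_index_lt c j : c < (m * m) ^ f -> j <= f -> c * f.+1 + j < 2 ^ W.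
Proof.
move=> cK jf; apply: (@size_array_le 10) => //; rewrite size_mkseq.
by apply: leq_trans (leq_pmulr _ _) => //; apply: ltnW; apply: mul_add_lt.
Qed.

Lemma eval_micro_entry e1 e2 c j t : c < (m * m) ^ f -> j <= f -> t < m ->
  ev e1 (c * f.+1 + j) -> ev e2 t ->
  ev (fetch 10 (Bin Add (Bin Mul e1 (param 18)) e2)) (micro_entry c j t).
Proof.
move=> cK jf tm ee1 ee2.
have := @eval_fetch2 10 e1 e2 18
  (fun k => micro_entry (k %/ m %/ f.+1) (k %/ m %% f.+1) (k %% m)) ((m * m) ^ f * f.+1) m
  (c * f.+1 + j) t.
rewrite divnMDl // (divn_small tm) addn0 !modnMDl (modn_small tm).
rewrite divnMDl // (divn_small (jf : j < f.+1)) addn0 (modn_small (jf : j < f.+1)).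
by apply=> //; apply: mul_add_lt.
Qed.

Lemma eval_class_index ec c : c < (m * m) ^ f -> ev ec c -> ev (Bin Mul ec (param 19)) (c * f.+1).
Proof.
move=> cK ecc; apply: eval_mul => //; first exact: (eval_param (isT : 19 < 24)).
by rewrite -[c * _]addn0; apply: class_index_lt.
Qed.

End Evaluation.

Lemma base_rank_le X c o : c * chunk + o <= span ->
  base_rank X <= rank far_block ((X * nc + c) * chunk + o) <= base_rank X + span.
Proof.
move=> co; rewrite mulnDl -mulnA -addnA leq_rank ?leq_addr //=.
by apply: leq_trans (rank_lip _ _ _) _; rewrite leq_add2l.
Qed.

Lemma chunk_field_lt X c : c < nc -> chunk_field X c < 2 ^ g.
Proof.
move=> cn; have := @base_rank_le X c 0; rewrite !addn0 leq_mul2r ltnW ?orbT // => /(_ isT).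
by rewrite /chunk_field; case: crowded; move: field_fits; clear; move: (rank _ _) (base_rank X) span (2 ^ g); lia.
Qed.

Lemma half_field a r (flag : bool) : a <= r -> a + (2 * (r - a) + flag) %/ 2 = r.
Proof. by case: flag; clear; lia. Qed.

Lemma flag_field k (flag : bool) : (2 * k + flag) %% 2 = flag.
Proof. by case: flag; clear; lia. Qed.

Lemma chunk_le : chunk <= 2 ^ g.
Proof. by move: field_fits m_le; case: nc => [|k]; lia. Qed.

(* Variables: 0 argument, 3 its micro-block and 4 its offset therein, 5 code of
   the micro-block, 8 current block, 10 class of that block, 11 threshold
   relative to that block, 12 micro-block of the answer within that block. *)
Definition find_block : cmd :=
  foldr Seq Skip
  [:: Let 15 (Bin Div (Var 11) (param 20));
      Let 16 (Bin Mod (Var 11) (param 20));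
      Let 17 (Bin Mod (Bin Shr (fetch 4 (Var 8)) (Bin Mul (Var 15) (param 21))) (param 22));
      Let 18 (Bin Add (fetch 3 (Var 8)) (Bin Div (Var 17) (Cst 2)));
      Let 19 (Bin Mod (Bin Shr (fetch 5 (Var 18)) (Bin Mul (Var 16) (param 21))) (param 22));
      Let 20 (fetch 6 (Bin Add (Var 18) (Bin Mul (Bin Mod (Var 17) (Cst 2)) (Var 19))));
      Let 11 (Bin Defs.Sub (Bin Add (Var 11) (fetch 2 (Var 8))) (fetch 2 (Var 20)));
      Let 8 (Var 20);
      Let 10 (fetch 1 (Var 8));
      Let 12 (fetch 10 (Bin Add (Bin Mul (Bin Mul (Var 10) (param 19)) (param 18)) (Var 11)))].

(** Common end of the two cases in which the answer leaves its micro-block: variables 8, 10, 11 and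
    12 must already describe the block of the answer. *)
Definition finish : cmd :=
  foldr Seq Skip
  [:: Let 21 (Bin Add (Bin Mul (Var 8) (param 14)) (Var 12));
      Let 22 (Bin Defs.Sub (Bin Add (Var 11) (param 13))
                (fetch 9 (Bin Add (Bin Mul (Var 10) (param 14)) (Var 12))));
      Let 23 (code_at (Var 21));
      Let 24 (fetch 11 (Bin Add (Bin Mul (Var 23) (param 23)) (Var 22)));
      Let 0 (Bin Defs.Sub (Bin Add (Bin Mul (Var 21) (param 13)) (Var 24)) (Var 0))].

(** [micro_entry] returns [f] if no later micro-block of the block qualifies; only then is the block
    changed by [find_block]. *)
Definition far_query : cmd :=
  foldr Seq Skip
  [:: Let 8 (Bin Div (Var 3) (param 14));
      Let 9 (Bin Mod (Var 3) (param 14));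
      Let 10 (fetch 1 (Var 8));
      Let 11 (Bin Defs.Sub
        (Bin Add (fetch 9 (Bin Add (Bin Mul (Var 10) (param 14)) (Var 9)))
           (fetch 8 (Bin Add (Bin Mul (Var 5) (param 13)) (Var 4))))
        (param 13));
      Let 12 (fetch 10 (Bin Add
        (Bin Mul (Bin Add (Bin Mul (Var 10) (param 19)) (Bin Add (Var 9) (Cst 1))) (param 18))
        (Var 11)));
      Let 13 (param 14);
      IfEq 12 13 find_block Skip;
      finish].

(** Variable 1 holds 0, the mark by which [near_entry] tells that the answer is outside the
    micro-block. *)
Definition large_query : cmd :=
  foldr Seq Skip
  [:: Let 3 (Bin Div (Var 0) (param 13));
      Let 4 (Bin Mod (Var 0) (param 13));
      Let 5 (code_at (Var 3));
      Let 7 (fetch 7 (Bin Add (Bin Mul (Var 5) (param 13)) (Var 4)));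
      IfEq 7 1 far_query (Let 0 (Var 7))].

(* Cell 0 is 0 if [n] is small; then the rest of the memory is the plain Lyndon
   array. *)
Definition query : cmd :=
  foldr Seq Skip
  [:: Let 1 (Cst 0);
      Let 2 (param 0);
      IfEq 1 2 (Let 0 (Deref (Bin Add (Var 0) (Cst 1)))) large_query].

(** * Correctness of the query program *)

Section Run.
Variables (i e : nat).
Hypothesis (next_e : is_next i e) (lt_in : i < n).
Local Notation x := (i %/ b).
Local Notation x' := (e %/ b).
Local Notation X := (x %/ f).
Local Notation X' := (x' %/ f).

Lemma position_fits k : k <= n -> k < 2 ^ W.
Proof. by move=> kn; apply: leq_ltn_trans n_fits. Qed.

(** Array 10 alone has at least [f.+1 * m] cells, and [f.+1] is at least 2. *)
Lemma double_m_fits : 2 * m < 2 ^ W.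
Proof.
apply: (@size_array_le 10) => //; rewrite size_mkseq leq_pmul2r //.
by rewrite -[2]mul1n leq_mul // expn_gt0.
Qed.

Lemma target_micro_lt : x' < NX * f.
Proof. by rewrite -ltn_divLR //; exact: target_block_lt next_e lt_in. Qed.

Lemma finish_run rho t : x < x' -> t < m -> t + V (X' * B) = h i + B -> rho 0 = i -> rho 8 = X' ->
  rho 10 = block_class X' -> rho 11 = t -> rho 12 = x' %% f ->
  exists2 rho', run W memory rho finish rho' & rho' 0 = e - i.
Proof.
move=> xx tm tE r0 r8 r10 r11 r12.
have en := is_next_le next_e lt_in; have [ie _ _] := next_e.
have xE := divn_eq x' f; have eE := divn_eq e b.
have xn : x' * b <= n by apply: leq_trans en; apply: leq_trunc_div.
have xfits : x' < 2 ^ W by apply: position_fits; apply: leq_trans xn; apply: leq_pmulr.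
have lt := ltn_pmod x' f_gt0.
have sE := start_entryE X' lt; rewrite -xE in sE.
have [le1 le2] := target_micro_threshold next_e lt_in xx.
set s := start_entry (block_class X') (x' %% f) in sE.
(* Both [t] and [s] are shifted by [B], which cancels; [b] is the shift used inside a
   micro-block. *)
have dE : t + b - s + V (x' * b) = h i + b by lia.
have oE := offset_entryE next_e lt_in xx dE.
have tb_fits : t + b < 2 ^ W.
  by apply: leq_ltn_trans double_m_fits; have : b <= B by [exact: leq_pmull]; lia.
have sub_ok : s <= t + b by lia.
eexists.
  apply: (@run_lete _ _ _ 21 _ (X' * f + x' %% f)) => //.
    apply: eval_add; last by rewrite -xE.
      apply: eval_mul; [exact: eval_varE|exact: (eval_param _ (isT : 14 < 24))|].
      by apply: leq_ltn_trans xfits; rewrite [X in _ <= X]xE leq_addr.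
    exact: eval_varE.
  rewrite -xE; apply: (@run_lete _ _ _ 22 _ (t + b - s)) => //.
    apply: eval_sub => //.
      apply: eval_add; [exact: eval_varE|exact: (eval_param _ (isT : 13 < 24))|done].
    have := @eval_fetch2 [eta rho with 21 |-> x'] 9 (Var 10) (Var 12) 14
      (fun k => start_entry (k %/ f) (k %% f)) ((m * m) ^ f) f (block_class X') (x' %% f).
    rewrite divnMDl // (divn_small lt) addn0 modnMDl (modn_small lt) -/s; apply=> //.
    - by apply: eval_varE.
    - by apply: eval_varE.
    - exact: block_class_lt.
  apply: (@run_lete _ _ _ 23 _ (micro_code x')) => //.
    by apply: eval_code_at target_micro_lt; apply: eval_varE.
  apply: (@run_lete _ _ _ 24 _ (e %% b)) => //.
    have := @eval_fetch2 [eta [eta [eta rho with 21 |-> x'] with 22 |-> t + b - s] with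
      23 |-> micro_code x'] 11 (Var 23) (Var 22) 23
      (fun k => offset_entry (k %/ (2 * b).+1) (k %% (2 * b).+1)) (2 ^ (2 * b)) (2 * b).+1
      (micro_code x') (t + b - s).
    have d_lt : t + b - s < (2 * b).+1 by lia.
    rewrite divnMDl // (divn_small d_lt) addn0 modnMDl (modn_small d_lt) oE; apply=> //.
    - by apply: eval_varE.
    - by apply: eval_varE.
    - exact: micro_code_lt.
  apply: (@run_lete _ _ _ 0 _ (x' * b + e %% b - i)) => //; last exact: run_skip.
  apply: eval_sub; last by rewrite -eE position_fits.
  - apply: eval_add; last by rewrite -eE position_fits.
      apply: eval_mul; [exact: eval_varE|exact: (eval_param _ (isT : 13 < 24))|].
      exact: position_fits.
    exact: eval_varE.
  - exact: eval_varE.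
  - by rewrite -eE ltnW.
by rewrite /= -eE.
Qed.

Lemma find_block_run rho t : X < X' -> t < m -> t + V (X * B) = h i + B -> rho 0 = i ->
  rho 8 = X -> rho 11 = t ->
  exists2 rho', run W memory rho find_block rho' &
    exists2 t', t' < m /\ t' + V (X' * B) = h i + B &
    [/\ rho' 0 = i, rho' 8 = X', rho' 10 = block_class X', rho' 11 = t' & rho' 12 = x' %% f].
Proof.
move=> XX tm tE r0 r8 r11.
have XN := source_block_lt next_e lt_in; have XN' := target_block_lt next_e lt_in.
have [le1 le2] := target_threshold next_e lt_in XX.
have hE := far_blockE next_e lt_in XX tm tE.
have tD := divn_eq t chunk; have o_lt := ltn_pmod t chunk_gt0.
have c_lt : t %/ chunk < nc by rewrite ltn_divLR // (leq_trans tm).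
set c := t %/ chunk in tD c_lt; set o := t %% chunk in tD o_lt.
pose C := X * nc + c.
have uE : X * span + t = C * chunk + o by rewrite /C mulnDl -mulnA -addnA -tD.
have CN : C < NX * nc by apply: mul_add_lt.
have uN : C * chunk + o < NX * nc * chunk by apply: mul_add_lt.
have ranks := rank_chunk far_block chunk_gt0 CN o_lt.
set r := rank far_block (C * chunk) in ranks.
(* The bound on the number of jumps keeps the rank inside the arrays 5 and 6. *)
have rank_le : rank far_block (C * chunk + o) <= 2 * NX by apply: rank_far_block; rewrite mulnA.
have r_le : r < (2 * NX).+1 by rewrite ltnS; apply: leq_trans rank_le; apply: leq_rank; apply: leq_addr.
have valE : value_at far_block (NX * nc) chunk (rank far_block (C * chunk + o)) = X'.
  by rewrite value_at_rank // -uE.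
have fieldE : digit (2 ^ g) (chunk_word X) c = chunk_field X c.
  by rewrite digit_pack_fun // => j; apply: chunk_field_lt.
have detailE : digit (2 ^ g) (detail_word r) o = detail far_block (NX * nc) chunk r o.
  rewrite digit_pack_fun // => j jc.
  by apply: leq_trans chunk_le; apply: detail_lt.
have base_le : base_rank X <= r.
  by have := @base_rank_le X c 0; rewrite !addn0 leq_mul2r ltnW ?orbT // => /(_ isT) /andP[].
have rE : base_rank X + chunk_field X c %/ 2 = r.
  exact: half_field.
have flagE : chunk_field X c %% 2 = crowded far_block chunk C.
  exact: flag_field.
have W_fits k : k <= W -> k < 2 ^ W by move=> kW; apply: leq_ltn_trans (ltn_expl W (ltnSn 1)).
have cg_fits : c * g < 2 ^ W.
  by apply: W_fits; apply: leq_trans fields_fit; rewrite mulnC leq_mul2l ltnW ?orbT.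
have og_fits : o * g < 2 ^ W.
  by apply: W_fits; apply: leq_trans chunk_fits; rewrite mulnC leq_mul2l ltnW ?orbT.
have rank_fits k : k <= 2 * NX -> k < 2 ^ W.
  by move=> kN; apply: (@size_array_le 5) => //; rewrite size_mkseq leqW.
pose t' := t + V (X * B) - V (X' * B).
have t'E : t' + V (X' * B) = h i + B by rewrite /t' tE subnK.
have t'm : t' < m.
  by move: t'E le2 block_len_gt0; move: t' (V (X' * B)) (h i) B; clear; lia.
(* The sum is [h i + B], at most [n / 2 + 1 + B], and both [n] and [2 * m] are words. *)
have tV_fits : t + V (X * B) < 2 ^ W.
  have := double_V_le i; have := h_le_V i; have := double_m_fits; rewrite tE.
  by move: n_fits; clear; move: (h i) (V i) B (2 ^ W); lia.
eexists.
  apply: (@run_lete _ _ _ 15 _ c) => //.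
    by apply: eval_div; [exact: eval_varE|exact: (eval_param _ (isT : 20 < 24))].
  apply: (@run_lete _ _ _ 16 _ o) => //.
    by apply: eval_mod; [exact: eval_varE|exact: (eval_param _ (isT : 20 < 24))].
  apply: (@run_lete _ _ _ 17 _ (chunk_field X c)) => //.
    rewrite -fieldE digitE; apply: eval_mod; last exact: (eval_param _ (isT : 22 < 24)).
    apply: eval_shr.
      by apply: (@eval_fetch_fun _ 4 _ _ chunk_word NX) => //; apply: eval_varE.
    by apply: eval_mul => //; [exact: eval_varE|exact: (eval_param _ (isT : 21 < 24))].
  apply: (@run_lete _ _ _ 18 _ r) => //.
    rewrite -rE; apply: eval_add; last by rewrite rE rank_fits.
      by apply: (@eval_fetch_fun _ 3 _ _ base_rank NX) => //; apply: eval_varE.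
    by apply: eval_div; [exact: eval_varE|exact: eval_small].
  apply: (@run_lete _ _ _ 19 _ (detail far_block (NX * nc) chunk r o)) => //.
    rewrite -detailE digitE; apply: eval_mod; last exact: (eval_param _ (isT : 22 < 24)).
    apply: eval_shr.
      by apply: (@eval_fetch_fun _ 5 _ _ detail_word (2 * NX).+1) => //; apply: eval_varE.
    by apply: eval_mul => //; [exact: eval_varE|exact: (eval_param _ (isT : 21 < 24))].
  apply: (@run_lete _ _ _ 20 _ X') => //.
    rewrite -[X in eval _ _ _ _ X]valE.
    apply: (@eval_fetch_fun _ 6 _ _ _ (2 * NX).+1) => //.
    rewrite ranks -flagE; apply: eval_add; last by rewrite flagE -ranks rank_fits.
      exact: eval_varE.
    apply: eval_mul; last by rewrite flagE rank_fits // (leq_trans _ rank_le) // ranks leq_addl.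
      by apply: eval_mod; [exact: eval_varE|exact: eval_small].
    exact: eval_varE.
  apply: (@run_lete _ _ _ 11 _ t') => //.
    apply: eval_sub => //; last by rewrite tE.
      apply: eval_add => //; first exact: eval_varE.
      by apply: (@eval_fetch_fun _ 2 _ _ (fun X => V (X * B)) NX) => //; apply: eval_varE.
    by apply: (@eval_fetch_fun _ 2 _ _ (fun X => V (X * B)) NX) => //; apply: eval_varE.
  apply: (@run_lete _ _ _ 8 _ X') => //; first exact: eval_varE.
  apply: (@run_lete _ _ _ 10 _ (block_class X')) => //.
    by apply: (@eval_fetch_fun _ 1 _ _ block_class NX) => //; apply: eval_varE.
  apply: (@run_lete _ _ _ 12 _ (x' %% f)) => //; last exact: run_skip.
  rewrite -(micro_entry_far next_e lt_in XX t'E).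
  have cK := block_class_lt X'.
  apply: eval_micro_entry => //; last exact: eval_varE.
  by rewrite addn0; apply: eval_class_index => //; apply: eval_varE.
by exists t'.
Qed.

Lemma far_query_run rho : x < x' -> rho 0 = i -> rho 3 = x -> rho 4 = i %% b ->
  rho 5 = micro_code x ->
  exists2 rho', run W memory rho far_query rho' & rho' 0 = e - i.
Proof.
move=> xx r0 r3 r4 r5.
have XN := source_block_lt next_e lt_in.
have xE := divn_eq x f; have lt := ltn_pmod x f_gt0; have ob := ltn_pmod i b_gt0.
have [le1 le2] := source_threshold lt_in.
have sE := start_entryE X lt; rewrite -xE in sE.
have rE := rel_thresholdE x ob; rewrite -divn_eq in rE.
set s := start_entry _ _ in sE; set r := rel_threshold _ _ in rE.
have s_le : s <= 2 * B.
  by move: sE (start_bounds X lt).1; rewrite -xE; clear; move: s (V (X * B)) (V (x * b)) B; lia.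
have r_le : r <= 2 * b.
  rewrite /r /rel_threshold /rel_height.
  have := ups_le (micro_code x) (i %% b); have := digit_lt (micro_code x) (i %% b) (isT : 0 < 4).
  by move: (ups _ _) (downs _ _) (digit _ _ _) ob; move: (i %% b); clear; lia.
have b_le : b <= B by apply: leq_pmull.
have sr_fits : s + r < 2 ^ W.
  apply: leq_ltn_trans (leq_add s_le r_le) _; apply: leq_ltn_trans double_m_fits.
  by move: b_le; move: B; clear; lia.
(* [s] is shifted by [B] and [r] by [b]; removing [b] leaves a threshold relative to the block,
   shifted by [B]. *)
have [sr_ge tE] : b <= s + r /\ s + r - b + V (X * B) = h i + B.
  have arith p q u v y z : p + u = v + z -> q + v = y + b -> u <= y + z ->
      b <= p + q /\ p + q - b + u = y + z by clear; lia.
  exact: arith sE rE le1.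
pose t := s + r - b; rewrite -/t in tE.
have tm : t < m.
  by move: tE le2; move: t (V (X * B)) (h i) B; clear; lia.
have cK := block_class_lt X.
pose y := micro_entry (block_class X) (x %% f).+1 t.
pose rho' := [eta [eta [eta [eta [eta [eta rho with 8 |-> X] with 9 |-> x %% f]
  with 10 |-> block_class X] with 11 |-> t] with 12 |-> y] with 13 |-> f].
suff [rho2 run2 fin] : exists2 rho2, run W memory rho' (foldr Seq Skip [:: IfEq 12 13 find_block Skip; finish]) rho2 &
    rho2 0 = e - i.
  exists rho2 => //.
  apply: (@run_lete _ _ _ 8 _ X) => //.
    by apply: eval_div; [exact: eval_varE|exact: (eval_param _ (isT : 14 < 24))].
  apply: (@run_lete _ _ _ 9 _ (x %% f)) => //.
    by apply: eval_mod; [exact: eval_varE|exact: (eval_param _ (isT : 14 < 24))].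
  apply: (@run_lete _ _ _ 10 _ (block_class X)) => //.
    by apply: (@eval_fetch_fun _ 1 _ _ block_class NX) => //; apply: eval_varE.
  apply: (@run_lete _ _ _ 11 _ t) => //.
    apply: eval_sub.
    - apply: eval_add.
      + have := @eval_fetch2 [eta [eta [eta rho with 8 |-> X] with 9 |-> x %% f] with 10 |-> block_class X]
          9 (Var 10) (Var 9) 14
          (fun k => start_entry (k %/ f) (k %% f)) ((m * m) ^ f) f (block_class X) (x %% f).
        rewrite divnMDl // (divn_small lt) addn0 modnMDl (modn_small lt) -/s; apply=> //.
        * by apply: eval_varE.
        * by apply: eval_varE.
      + have := @eval_fetch2 [eta [eta [eta rho with 8 |-> X] with 9 |-> x %% f] with 10 |-> block_class X]
          8 (Var 5) (Var 4) 13
          (fun k => rel_threshold (k %/ b) (k %% b)) (2 ^ (2 * b)) b (micro_code x) (i %% b).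
        rewrite divnMDl // (divn_small ob) addn0 modnMDl (modn_small ob) -/r; apply=> //.
        * by apply: eval_varE.
        * by apply: eval_varE.
        * exact: micro_code_lt.
      + exact: sr_fits.
    - exact: (eval_param _ (isT : 13 < 24)).
    - exact: sr_ge.
    - exact: sr_fits.
  apply: (@run_lete _ _ _ 12 _ y) => //.
    apply: eval_micro_entry => //; last exact: eval_varE.
    have fit := class_index_lt cK lt.
    apply: eval_add => //.
      by apply: eval_class_index => //; apply: eval_varE.
    rewrite -[(x %% f).+1]addn1; apply: eval_add; [exact: eval_varE|exact: eval_small|].
    by rewrite addn1; apply: leq_ltn_trans fit; apply: leq_addl.
  by apply: (@run_lete _ _ _ 13 _ f) => //; exact: (eval_param _ (isT : 14 < 24)).
(* If the answer leaves the block, [y] is [f] and [find_block] runs; otherwise [y] is a remainder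
   modulo [f], and the test against [f] fails. *)
case: (ltngtP X X') (leq_target_block next_e) => // XX _.
  have yE : y = f by apply: (micro_entry_none next_e lt_in).
  have [rho3 run3 [t' [t'm t'E] [q0 q8 q10 q11 q12]]] :=
    @find_block_run rho' t XX tm tE r0 erefl erefl.
  have [rho4 run4 fin] := finish_run xx t'm t'E q0 q8 q10 q11 q12.
  exists rho4 => //; apply: run_seq; last by apply: run_seq run4 _; exact: run_skip.
  by apply: run_ifeq => //=; rewrite yE eqxx.
have yE : y = x' %% f by apply: (micro_entry_same next_e lt_in).
rewrite XX in tE.
have [rho4 run4 fin] := @finish_run rho' t xx tm tE r0 XX (congr1 _ XX) erefl yE.
exists rho4 => //; apply: run_seq; last by apply: run_seq run4 _; exact: run_skip.
apply: run_ifeq => //=; rewrite yE ltn_eqF ?ltn_pmod //; exact: run_skip.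
Qed.

Lemma query_run rho : rho 0 = i ->
  exists2 rho', run W memory rho query rho' & rho' 0 = e - i.
Proof.
move=> r0; have ob := ltn_pmod i b_gt0.
have [ie _ _] := next_e; have en := is_next_le next_e lt_in.
have xN : x < NX * f by apply: leq_ltn_trans target_micro_lt; apply: leq_target_micro next_e.
have nE := near_entryE next_e lt_in.
(* Since [i < e], the value 0 cannot be confused with a distance. *)
pose a := if x' == x then e - i else 0.
pose rho' := [eta [eta [eta [eta [eta [eta rho with 1 |-> 0] with 2 |-> 1]
  with 3 |-> x] with 4 |-> i %% b] with 5 |-> micro_code x] with 7 |-> a].
suff [rho2 run2 fin] : exists2 rho2, run W memory rho' (IfEq 7 1 far_query (Let 0 (Var 7))) rho2 &
    rho2 0 = e - i.
  exists rho2 => //.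
  apply: (@run_lete _ _ _ 1 _ 0) => //; first exact: eval_small.
  apply: (@run_lete _ _ _ 2 _ 1) => //; first exact: (eval_param _ (isT : 0 < 24)).
  apply: run_seq; last exact: run_skip.
  apply: run_ifeq => //=.
  apply: (@run_lete _ _ _ 3 _ x) => //.
    by apply: eval_div; [exact: eval_varE|exact: (eval_param _ (isT : 13 < 24))].
  apply: (@run_lete _ _ _ 4 _ (i %% b)) => //.
    by apply: eval_mod; [exact: eval_varE|exact: (eval_param _ (isT : 13 < 24))].
  apply: (@run_lete _ _ _ 5 _ (micro_code x)) => //.
    by apply: eval_code_at => //; apply: eval_varE.
  apply: (@run_lete _ _ _ 7 _ a) => //.
    have := @eval_fetch2 [eta [eta [eta [eta [eta rho with 1 |-> 0] with 2 |-> 1]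
      with 3 |-> x] with 4 |-> i %% b] with 5 |-> micro_code x] 7 (Var 5) (Var 4) 13
      (fun k => near_entry (k %/ b) (k %% b)) (2 ^ (2 * b)) b (micro_code x) (i %% b).
    rewrite divnMDl // (divn_small ob) addn0 modnMDl (modn_small ob) nE; apply=> //.
    - by apply: eval_varE.
    - by apply: eval_varE.
    - exact: micro_code_lt.
  by apply: run_seq run2 _; exact: run_skip.
case: (ltngtP x x') (leq_target_micro next_e) => // xx _.
  have [rho3 run3 fin] := @far_query_run rho' xx r0 erefl erefl erefl.
  exists rho3 => //; apply: run_ifeq => //=.
  by rewrite /a (gtn_eqF xx); exact: run3.
eexists.
  apply: run_ifeq => //=; rewrite /a xx eqxx subn_eq0 leqNgt ie /=.
  by apply: run_let => //; apply: eval_varE.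
by rewrite /= /a xx eqxx.
Qed.

End Run.

(** A closed form without [V] and [h], so that the redundancy is a function of the length alone. *)
Definition memory_size :=
  24 + ((NX * f %/ c0).+1 + 4 * NX + 2 * (2 * NX).+1 + 2 * (2 ^ (2 * b) * b) + (m * m) ^ f * f
    + (m * m) ^ f * f.+1 * m + 2 ^ (2 * b) * (2 * b).+1).

Lemma size_memory : size memory = memory_size.
Proof.
rewrite size_cat size_header size_flatten /shape /arrays /memory_size; congr (24 + _).
rewrite !map_cons !size_mkseq /=; move: (NX * f %/ c0).+1 NX (2 ^ (2 * b) * b) ((m * m) ^ f * f).
by move: ((m * m) ^ f * f.+1 * m) (2 ^ (2 * b) * (2 * b).+1); clear; lia.
Qed.

Lemma memory_words : all (is_word W) memory.
Proof.
have W_fits k : k <= W -> k < 2 ^ W by move=> kW; apply: leq_ltn_trans (ltn_expl W (ltnSn 1)).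
have all_mkseq F N : (forall k, k < N -> F k < 2 ^ W) -> all (is_word W) (mkseq F N).
  by move=> FN; apply/allP=> a /mapP[k]; rewrite mem_iota => /FN lt ->.
have g_gt0 : 0 < g by case: g field_fits => // ; rewrite addn2.
have b_le : b <= B by apply: leq_pmull.
have f_le : f <= B by apply: leq_pmulr.
have dm := double_m_fits.
have m_fits k : k <= 2 * m -> k < 2 ^ W by move=> km; apply: leq_ltn_trans dm.
have NX_fits k : k <= 2 * NX -> k < 2 ^ W.
  by move=> kN; apply: (@size_array_le 5) => //; rewrite size_mkseq leqW.
have tb_lt : 2 * b < W by apply: leq_trans codes_fit; rewrite -[X in X < _]muln1 ltn_pmul2l ?muln_gt0.
rewrite all_cat; apply/andP; split.
  rewrite (_ : header = [:: 1] ++ mkseq array_base 12 ++ parameters) // !all_cat; apply/and3P; split.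
  - by rewrite /= andbT; apply: m_fits.
  - apply: all_mkseq => k k12; apply: leq_ltn_trans memory_fits.
    rewrite size_cat size_header leq_add2l size_flatten.
    by rewrite -[X in _ <= sumn X](cat_take_drop k) sumn_cat leq_addr.
  rewrite /= andbT /is_word !ltn_exp2l // tb_lt.
  do ![apply/andP; split] => //; try by (apply: m_fits; lia).
  - apply: W_fits; apply: leq_trans codes_fit; apply: leq_pmull; by rewrite muln_gt0.
  - by apply/W_fits/leq_trans/chunk_fits/leq_pmull.
  - by apply/W_fits/leq_trans/chunk_fits/leq_pmulr.
  - by apply: leq_trans chunk_fits; rewrite -[X in X < _]muln1 ltn_pmul2l.
have all_flat (ss : seq (seq nat)) : all (all (is_word W)) ss -> all (is_word W) (flatten ss).
  by elim: ss => //= s ss IH /andP[hs /IH]; rewrite all_cat hs.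
have pack_fits k l q : 2 ^ k <= 2 ^ W -> l <= k -> q < 2 ^ l -> q < 2 ^ W.
  by move=> kW lk ql; apply: leq_trans ql (leq_trans _ kW); rewrite leq_exp2l.
have V_fits X : V (X * B) < 2 ^ W.
  by apply: leq_ltn_trans n_fits; have := double_V_le (X * B); clear; move: (V _); lia.
have rank_fits u : u < NX * span -> rank far_block u < 2 ^ W.
  by move=> uN; apply: NX_fits; apply: rank_far_block.
apply: all_flat.
apply/andP; split.
  apply: all_mkseq => k kN; apply: (@pack_fits W (2 * b * c0)) => //.
  by rewrite expnM; apply: pack_fun_lt => j _; apply: micro_code_lt.
apply/andP; split.
  apply: all_mkseq => k kN; apply: leq_trans (block_class_lt k) _; apply: ltnW.
  by apply: (@size_array_le 9) => //; rewrite size_mkseq leq_pmulr.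
apply/andP; split.
  by apply: all_mkseq => k kN; apply: V_fits.
apply/andP; split.
  by apply: all_mkseq => k kN; apply: rank_fits; rewrite ltn_pmul2r ?span_gt0.
apply/andP; split.
  apply: all_mkseq => k kN; apply: (@pack_fits W (g * nc)) => //.
  by rewrite expnM; apply: pack_fun_lt => j; apply: chunk_field_lt.
apply/andP; split.
  apply: all_mkseq => k kN; apply: (@pack_fits W (g * chunk)) => //.
  rewrite expnM; apply: pack_fun_lt => j jc.
  by apply: leq_trans chunk_le; apply: detail_lt.
apply/andP; split.
  apply: all_mkseq => k kN; apply: NX_fits; rewrite /value_at.
  set u := find _ _.
  (* For a rank that does not occur, [find] returns [NX * span], one past the last argument; the
     stored value is then still at most [NX.+1]. *)
  have uN : u %/ span <= NX.
    rewrite -[X in _ <= X](mulnK NX span_gt0) leq_div2r // mulnA -[X in _ <= X](size_iota 0).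
    exact: find_size.
  rewrite /far_block; set t := maxn _ _.
  have /andP[_ le] := first_below_le block_min t (u %/ span).+1 (NX - (u %/ span).+1).
  apply: leq_trans le _; have : 0 < NX by [].
  by move: (u %/ span) NX uN; clear; lia.
apply/andP; split.
  apply: all_mkseq => k kN; apply: m_fits; rewrite /near_entry.
  case: ifP => // kb; apply: leq_trans (leq_subr _ _) _; apply: leq_trans (ltnW kb) _.
  by move: b_le; move: B; clear; lia.
apply/andP; split.
  apply: all_mkseq => k kN; apply: m_fits; rewrite /rel_threshold /rel_height.
  have kb := ltn_pmod k b_gt0.
  have := ups_le (k %/ b) (k %% b); have := digit_lt (k %/ b) (k %% b) (isT : 0 < 4).
  by move: (ups _ _) (downs _ _) (digit _ _ _) kb b_le; move: (k %% b) B; clear; lia.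
apply/andP; split.
  apply: all_mkseq => k kN; apply: m_fits; rewrite /start_entry.
  apply: ltnW; apply: (@leq_trans m); last by rewrite mul2n -addnn leq_addr.
  by rewrite ltn_divLR //; apply: digit_lt; rewrite muln_gt0.
apply/andP; split.
  apply: all_mkseq => k kN; apply: m_fits; rewrite /micro_entry.
  apply: leq_trans (andP (first_below_le _ _ _ _)).2 _.
  rewrite subnKC; last by rewrite -ltnS ltn_pmod.
  by move: f_le; move: B; clear; lia.
apply/andP; split.
  apply: all_mkseq => k kN; apply: m_fits; rewrite /offset_entry.
  apply: leq_trans (andP (first_below_le _ _ _ _)).2 _.
  by move: b_le; move: B; clear; lia.
by [].
Qed.

Lemma structure_answers i e : is_next i e -> i < n ->
  answers W (compile 0 query) (size (compile 0 query)) memory i (e - i).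
Proof. by move=> ie lt_in; apply: run_answers => rho; apply: query_run. Qed.
End Structure.

(** The same program must also serve the lengths for which the structure is not built; the flag 0
    selects plain lookup, with positions shifted by one cell. *)
Lemma plain_answers w s i : i < size s -> size s < 2 ^ w ->
  answers w (compile 0 query) (size (compile 0 query)) (0 :: s) i (nth 0 s i).
Proof.
move=> i_lt fits; apply: run_answers => rho r0.
have fit k : k <= size s -> k < 2 ^ w by move=> ks; apply: leq_ltn_trans fits.
eexists.
  apply: (@run_lete _ _ _ 1 _ 0) => //; first by apply/eval_cst/fit.
  apply: (@run_lete _ _ _ 2 _ 0) => //.
    by apply: (@eval_deref _ _ _ _ 0) => //; apply/eval_cst/fit.
  apply: run_seq; last exact: run_skip.
  apply: run_ifeq => //=; apply: run_let => //.
  apply: (@eval_deref _ _ _ _ (i + 1)); last by rewrite addn1.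
  by apply: eval_add; [exact: eval_varE | apply/eval_cst/fit/(leq_trans _ i_lt)
    | rewrite addn1; apply: fit].
by rewrite /= addn1.
Qed.

(** * Choice of the parameters *)

(** With [y = x %/ 2], [2 ^ x] is at least [2 ^ y * 2 ^ y]: one factor absorbs the induction
    hypothesis, the other the extra power of [y]. The 3 comes from [x <= 3 * y]. *)
Lemma polynomial_le_exp k a : exists N, forall x, N <= x -> a * x ^ k <= 2 ^ x.
Proof.
elim: k a => [|k IH] a.
  by exists a => x ax; rewrite expn0 muln1; apply: leq_trans ax (ltnW (ltn_expl x _)).
have [N hN] := IH (a * 3 ^ k.+1); exists (2 * N + 2) => x Nx.
have x3 : x <= 3 * (x %/ 2) by lia.
have yN : N <= x %/ 2 by lia.
have yy : x %/ 2 + x %/ 2 <= x by lia.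
move: (x %/ 2) x3 yN yy => y x3 yN yy.
have le1 : a * x ^ k.+1 <= a * (3 * y) ^ k.+1 by rewrite leq_mul2l leq_exp2r ?x3 ?orbT.
have le2 : 2 ^ y * 2 ^ y <= 2 ^ x by rewrite -expnD leq_exp2l.
apply: leq_trans le1 (leq_trans _ le2); rewrite expnMn [y ^ _]expnSr !mulnA.
by apply: leq_mul; [apply: hN|apply: ltnW; apply: ltn_expl].
Qed.

Section Asymptotics.
Variables (w : nat -> nat) (c : nat).
Hypothesis c_gt0 : 0 < c.
Hypothesis w_fits : forall n, n < 2 ^ w n.

(** With [w n <= c * log n], a code of [2 * micro_len n] bits has at most a quarter of [log n] bits,
    which keeps the tables indexed by codes small. *)
Definition codes_per_word := 4 * c.
Definition micro_len n := w n %/ (2 * codes_per_word).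
Definition fanout n := trunc_log 2 (w n).
Definition field_width n := 4 * fanout n.
Definition chunk_len n := w n %/ field_width n.
(** The least number of chunks that covers the [2 * B + 1] thresholds of a block. *)
Definition num_chunks n := (2 * block_len (micro_len n) (fanout n) %/ chunk_len n).+1.
Definition total_size n := memory_size n (micro_len n) (fanout n) codes_per_word.

Definition large n :=
  [&& 0 < micro_len n, 0 < fanout n, 1 < chunk_len n,
      field_width n * num_chunks n <= w n,
      2 * (num_chunks n * chunk_len n) + 2 <= 2 ^ field_width n
    & total_size n < 2 ^ w n].

(** Bounds the excess over [2 * n] bits, times the fanout and divided by [n]; the excess is thus
    [O(n / log w)]. *)
Definition excess_factor := 32 * codes_per_word + 6.

(** * Estimates for large lengths *)

Section Bounds.
Variables (n L W v b : nat).
Let c0 := codes_per_word.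
Let B := v * b.
Let chunk := W %/ (4 * v).
Let nc := (2 * B %/ chunk).+1.
Let m := (2 * B).+1.
Let S := memory_size n b v c0.
Hypotheses (nL : 2 ^ L <= n) (WL : W <= c * L) (LW : L < W).
Hypotheses (vW : 2 ^ v <= W) (Wv : W < 2 ^ v.+1).
Hypothesis bE : b = W %/ (2 * c0).
Hypotheses (v_large : 1000 * c * v ^ 4 <= 2 ^ v) (v_gt2 : 2 < v).
Hypothesis L_large : 1000 * (c * L) ^ 5 <= 2 ^ (L %/ 4).
Hypothesis W_large : excess_factor + 2 <= W.

Let z := 2 ^ v.

Lemma v_gt0 : 0 < v. Proof. exact: ltnW (ltnW v_gt2). Qed.

Lemma v_pow_le : 1000 * c * v ^ 4 <= W. Proof. exact: leq_trans v_large vW. Qed.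

Lemma v2_le : 1000 * (c * (v * v)) <= W.
Proof.
apply: leq_trans v_pow_le; rewrite -mulnA leq_mul2l /= leq_mul2l.
by rewrite (_ : v ^ 4 = v * v * (v * v)) ?leq_pmulr ?orbT ?muln_gt0 //; [lia | rewrite !expnS expn0; lia].
Qed.

Lemma v3_le : 1000 * (v * v * v) <= W.
Proof.
apply: leq_trans v_pow_le; rewrite -[1000 * c * _]mulnA leq_mul2l /=.
rewrite (_ : v ^ 4 = v * v * v * v); last by rewrite !expnS expn0; lia.
by apply: leq_trans (leq_pmull _ c_gt0); apply: leq_pmulr; lia.
Qed.

Lemma W_lt_b : W < 2 * c0 * b.+1.
Proof. by rewrite mulnC bE -ltn_divLR // muln_gt0 /= muln_gt0. Qed.

Lemma b_le_W : 2 * c0 * b <= W.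
Proof. by rewrite mulnC bE leq_trunc_div. Qed.

Lemma b4_le : 8 * b <= W.
Proof. by apply: leq_trans b_le_W; rewrite leq_mul2r /c0 /codes_per_word; move: c_gt0; clear; lia. Qed.

Lemma v_lt_b : v < b.
Proof.
rewrite ltnNge; apply/negP=> bv.
have vv : v.+1 <= v * v by move: v_gt2; clear; nia.
have : c * b.+1 <= c * (v * v) by rewrite leq_mul2l (leq_trans _ vv) ?orbT.
have : 2 * c0 * b.+1 = 8 * (c * b.+1) by rewrite /c0 /codes_per_word; clear; lia.
by move: W_lt_b v2_le; move: (c * b.+1) (c * (v * v)) (2 * c0 * b.+1); clear; lia.
Qed.

Lemma chunk_gt1 : 1 < chunk.
Proof.
rewrite /chunk leq_divRL ?muln_gt0 ?(ltnW (ltnW v_gt2)) //.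
have vv : v <= v * v * v by rewrite leq_pmull // muln_gt0 (ltnW (ltnW v_gt2)).
by move: v3_le vv; move: (v * v * v); clear; lia.
Qed.

Lemma W_lt_chunk : W <= 8 * v * chunk.
Proof.
have : W < chunk.+1 * (4 * v) by rewrite -ltn_divLR ?muln_gt0 ?(ltnW (ltnW v_gt2)).
by move: chunk_gt1; move: chunk; clear; nia.
Qed.

(** As [b <= v * chunk], the [2 * v * b] thresholds take [O(v ^ 2)] chunks; their fields then need
    only [O(v ^ 3)] bits, which fit into one word. *)
Lemma bound_nc : nc <= 16 * (v * v) + 1.
Proof.
rewrite /nc addn1 ltnS; have ch := ltnW chunk_gt1.
rewrite -ltnS ltn_divLR //.
have : b <= v * chunk by have := leq_trans b4_le W_lt_chunk; rewrite -mulnA leq_pmul2l.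
have -> : 2 * B = 2 * v * b by rewrite mulnA.
move=> le; apply: (@leq_ltn_trans (2 * v * (v * chunk))); first by rewrite leq_mul2l le orbT.
have -> : 2 * v * (v * chunk) = 2 * (v * v) * chunk by rewrite -!mulnA; congr (2 * _); rewrite mulnCA.
by rewrite ltn_pmul2r //; move: (v * v); clear; lia.
Qed.

Lemma fields_ok : 4 * v * nc <= W.
Proof. by move: bound_nc v3_le (v_gt2); move: nc; clear; nia. Qed.

Lemma v_lt_z : v < z. Proof. exact: ltn_expl. Qed.
Lemma W_lt_z : W < 2 * z. Proof. by rewrite -expnS. Qed.

(** The origin of the 4 in the field width: [span] is of order at most [z * z], whereas [4 * v] bits
    reach [z ^ 4]. *)
Lemma field_ok : 2 * (nc * chunk) + 2 <= 2 ^ (4 * v).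
Proof.
have le1 : nc * chunk <= 2 * B + chunk.
  by rewrite /nc mulSn addnC leq_add2r leq_trunc_div.
have le2 : chunk <= W by apply: leq_div.
have -> : 2 ^ (4 * v) = z * z * (z * z) by rewrite mulnC expnM -/z !expnS expn0; lia.
have z8 : 8 <= z by rewrite -[8]/(2 ^ 3) leq_exp2l.
have : 2 * B + W <= 2 * (z * z) + 2 * z.
  have := v_lt_z; have := W_lt_z; have := b4_le; rewrite /B; clear; nia.
have : 2 * (2 * (z * z) + 2 * z) + 2 <= z * z * (z * z).
  by move: z z8 => y y8; clear -y8; nia.
by move: le1 le2; move: (nc * chunk) chunk (z * z * (z * z)) (2 * B); clear; lia.
Qed.

Let Z := 2 ^ (L %/ 4).

(** From [8 * c * b <= W <= c * L], a code has at most [L / 4] bits. *)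
Lemma R_le : 2 ^ (2 * b) <= Z.
Proof.
rewrite leq_exp2l // leq_divRL // -(leq_pmul2l c_gt0); apply: leq_trans WL.
have -> : c * (2 * b * 4) = 2 * c0 * b by rewrite /c0 /codes_per_word; clear; lia.
exact: b_le_W.
Qed.

(** As [m <= 2 ^ (2 * v)], a block class has at most [4 * v ^ 2] bits, and [1000 * v ^ 2 <= L]. *)
Lemma Q_le : (m * m) ^ v <= Z.
Proof.
have mz : m <= 2 ^ (2 * v).
  have -> : 2 ^ (2 * v) = z * z by rewrite mulnC expnM -/z !expnS expn0; lia.
  by rewrite /m /B; have := v_lt_z; have := W_lt_z; have := b4_le; clear; nia.
apply: (@leq_trans ((2 ^ (2 * v) * 2 ^ (2 * v)) ^ v)); first by rewrite leq_exp2r ?leq_mul ?v_gt0.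
rewrite -expnD -expnM leq_exp2l // leq_divRL //.
have : 1000 * (v * v) <= L by rewrite -(leq_pmul2l c_gt0) mulnCA; apply: leq_trans v2_le WL.
by clear; nia.
Qed.

Lemma m_le_W : m <= W * W.
Proof. by rewrite /m /B; have := v_lt_b; have := b4_le; clear; nia. Qed.

(** The 26 collects the 24 header cells and the two extra cells of the arrays of size
    [2 * NX + 1]. *)
Let tables := 26 + (2 * (2 ^ (2 * b) * b) + (m * m) ^ v * v + (m * m) ^ v * v.+1 * m
  + 2 ^ (2 * b) * (2 * b).+1).

Lemma Z_gt0 : 0 < Z. Proof. by rewrite expn_gt0. Qed.

Lemma W5_le : 1000 * W ^ 5 <= Z.
Proof. by apply: leq_trans L_large; rewrite leq_mul2l leq_exp2r. Qed.

Lemma ZZ_le : Z * Z <= n.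
Proof. by apply: leq_trans nL; rewrite -expnD leq_exp2l //; clear; lia. Qed.

Lemma W_gt0 : 0 < W. Proof. exact: leq_ltn_trans LW. Qed.

Lemma tables_le : tables <= Z * (40 * W ^ 3).
Proof.
rewrite /tables (_ : W ^ 3 = W * (W * W)); last by rewrite !expnS expn0; clear; lia.
move: R_le Q_le m_le_W Z_gt0 b4_le v_lt_b W_gt0.
move: (2 ^ (2 * b)) m Z; clear=> R M y; move: ((M * M) ^ v) => Q Ry Qy MW y0 bW vb W0.
have [vW vW1] : v <= W /\ v.+1 <= W by lia.
have [bW1 bW2] : b <= W /\ (2 * b).+1 <= W by lia.
have h1 : R * b <= y * W by apply: leq_mul.
have h2 : Q * v <= y * W by apply: leq_mul.
have h3 : Q * v.+1 * M <= y * W * (W * W) by apply: leq_mul => //; apply: leq_mul.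
have h4 : R * (2 * b).+1 <= y * W by apply: leq_mul.
have h5 : y * W <= y * W * (W * W) by apply: leq_pmulr; rewrite muln_gt0 W0.
have h6 : 26 <= 26 * (y * W) by rewrite leq_pmulr // muln_gt0 y0.
have -> : y * (40 * (W * (W * W))) = 40 * (y * W * (W * W)) by lia.
move: h1 h2 h3 h4 h5 h6; move: (y * W * (W * W)) (y * W) (Q * v.+1 * M) (R * b) (Q * v) (R * _).
by clear; lia.
Qed.

(** Each table has at most [Z] rows of length polynomial in [W], while [1000 * W ^ 5 <= Z] and
    [Z * Z <= n]. *)
Lemma tables_small : tables * W * v <= n.
Proof.
have vW1 : v <= W by apply: leq_trans (ltnW v_lt_b) _; apply: leq_trans b4_le; apply: leq_pmull.
apply: leq_trans ZZ_le; apply: (@leq_trans (Z * (40 * W ^ 3) * W * W)).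
  by rewrite !leq_mul ?tables_le.
rewrite -!mulnA leq_mul2l; apply/orP; right; apply: leq_trans W5_le.
by rewrite !expnS expn0; clear; nia.
Qed.

(** The factor [v] expresses an overhead of [O(n / v)] bits without division. The codes give [2 * n]
    and a lower-order term; the arrays indexed by blocks or ranks give [O(n / v)], because a block
    has [v * b] positions and [W] is [O(b)]. *)
Lemma size_bound : S * W * v <= 2 * n * v + excess_factor * n.
Proof.
have vb := v_lt_b; have Wb := W_lt_b; have bW := b4_le.
have T := tables_small.
set a := n %/ (v * b).
have aE : a * (v * b) <= n by apply: leq_trunc_div.
set NW := ((a.+1 * v) %/ c0).+1.
have SE : S = NW + 8 * a.+1 + tables.
  rewrite /S /memory_size /num_blocks /block_len /tables -/a -/B -/m -/NW.
  rewrite /m; move: NW (2 ^ (2 * b) * b) (2 ^ (2 * b) * (2 * b).+1) (2 * B).+1; clear=> k p q u.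
  by move: ((u * u) ^ v * v) ((u * u) ^ v * v.+1 * u); lia.
have c0_gt0 : 0 < c0 by rewrite muln_gt0.
have NWle : NW * c0 <= a.+1 * v + c0 by rewrite /NW mulSn addnC leq_add2r leq_trunc_div.
have W3 : 1000 * (W * (W * W)) <= n.
  apply: leq_trans ZZ_le; apply: leq_trans (leq_pmulr _ Z_gt0); apply: leq_trans W5_le.
  rewrite leq_mul2l /= (_ : W ^ 5 = W * (W * W) * (W * W)); last by rewrite !expnS expn0; lia.
  by apply: leq_pmulr; rewrite muln_gt0 W_gt0.
have c0W : c0 <= W.
  by apply: leq_trans W_large; rewrite /excess_factor -/c0; clear; move: c0; lia.
have vW1 : v <= W by apply: leq_trans (ltnW vb) _; apply: leq_trans bW; apply: leq_pmull.
have b1W : b.+1 <= W by move: bW vb; clear; lia.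
have h1 : NW * W * v <= 2 * n * v + 3 * n.
  (* The summand [2 * (a * v)] is the cost of rounding [b] down; times [v] it is still [O(n)],
     because [v < b]. *)
  have le1 : NW * W <= 2 * n + 2 * (a * v) + 2 * (b.+1 * (v + c0)).
    apply: (@leq_trans (NW * (2 * c0 * b.+1))); first by rewrite leq_mul2l ltnW ?orbT.
    have -> : NW * (2 * c0 * b.+1) = 2 * b.+1 * (NW * c0).
      by clear; move: NW c0 => p q; lia.
    apply: (@leq_trans (2 * b.+1 * (a.+1 * v + c0))); first by rewrite leq_mul2l NWle orbT.
    have -> : 2 * b.+1 * (a.+1 * v + c0) = 2 * (a * (v * b)) + 2 * (a * v) + 2 * (b.+1 * (v + c0)).
      by clear; move: a c0 => p q; lia.
    by rewrite !leq_add2r leq_mul2l.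
  have le2 : a * v * v <= n by apply: leq_trans aE; rewrite -mulnA leq_mul2l leq_mul2l (ltnW vb) !orbT.
  have le3 : b.+1 * (v + c0) * v <= W * (W + W) * W by rewrite !leq_mul ?leq_add.
  apply: (@leq_trans ((2 * n + 2 * (a * v) + 2 * (b.+1 * (v + c0))) * v)).
    by rewrite leq_mul2r le1 orbT.
  have -> : (2 * n + 2 * (a * v) + 2 * (b.+1 * (v + c0))) * v =
      2 * n * v + (2 * (a * v * v) + 2 * (b.+1 * (v + c0) * v)).
    by clear; move: a c0 => p q; lia.
  rewrite leq_add2l.
  have WE : W * (W + W) * W = 2 * (W * (W * W)) by clear; lia.
  rewrite WE in le3.
  move: le2 le3 W3.
  by move: (a * v * v) (b.+1 * (v + c0) * v) (W * (W * W)); clear; lia.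
(* The 8 words per block are four arrays of [NX] words and two of about [2 * NX]. *)
have h2 : 8 * a.+1 * W * v <= 32 * c0 * n + n.
  have le1 : a * W * v <= 4 * c0 * n.
    apply: (@leq_trans (a * (2 * c0 * b.+1) * v)); first by rewrite leq_mul2r leq_mul2l (ltnW Wb) !orbT.
    apply: (@leq_trans (4 * c0 * (a * (v * b)))); last by rewrite leq_mul2l aE orbT.
    have -> : 4 * c0 * (a * (v * b)) = a * (2 * c0 * (2 * b)) * v by clear; move: a c0 => p q; lia.
    rewrite leq_mul2r leq_mul2l leq_mul2l; do 3![apply/orP; right].
    by move: (leq_ltn_trans (leq0n v) vb); clear; lia.
  have le2 : W * v <= W * (W * W).
    by rewrite leq_mul //; apply: leq_trans vW1 _; apply: leq_pmulr; apply: W_gt0.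
  have -> : 8 * a.+1 * W * v = 8 * (a * W * v) + 8 * (W * v) by clear; move: a => p; lia.
  have -> : 32 * c0 * n = 8 * (4 * c0 * n) by clear; move: c0 => p; lia.
  by move: le1 le2 W3; move: (a * W * v) (4 * c0 * n) (W * v) (W * (W * W)); clear; lia.
rewrite SE [_ * W]mulnDl [_ * v]mulnDl [(NW + _) * W]mulnDl [(NW * W + _) * v]mulnDl.
have -> : excess_factor * n = 32 * c0 * n + 6 * n by rewrite /excess_factor -/c0 mulnDl.
move: h1 h2 T; move: (NW * W * v) (8 * a.+1 * W * v) (tables * W * v) (2 * n * v) (32 * c0 * n).
by clear; lia.
Qed.

(** Ensures that every address of the structure is a word. *)
Lemma size_le : S <= n.
Proof.
rewrite -(leq_pmul2r W_gt0) -(leq_pmul2r v_gt0).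
apply: leq_trans size_bound _; apply: (@leq_trans ((excess_factor + 2) * (n * v))); last first.
  by rewrite [n * W]mulnC -mulnA leq_mul2r W_large orbT.
have le1 : excess_factor * n <= excess_factor * (n * v) by rewrite leq_mul2l leq_pmulr ?v_gt0 ?orbT.
have -> : (excess_factor + 2) * (n * v) = 2 * n * v + excess_factor * (n * v).
  by rewrite mulnDl addnC mulnA.
by rewrite leq_add2l.
Qed.

End Bounds.

Hypothesis w_small : exists N, forall n, N <= n -> w n <= c * trunc_log 2 n.

Lemma trunc_log_lt_w n : 0 < n -> trunc_log 2 n < w n.
Proof.
move=> n0; rewrite -(ltn_exp2l _ _ (ltnSn 1)).
exact: leq_ltn_trans (trunc_logP _ n0) (w_fits n).
Qed.

Lemma trunc_log_large k n : 2 ^ k <= n -> k <= trunc_log 2 n.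
Proof. by move=> kn; rewrite -(trunc_expnK k (ltnSn 1)); apply: leq_trunc_log. Qed.

Lemma fanout_large k : exists N, forall n, N <= n -> k <= fanout n.
Proof.
exists (2 ^ 2 ^ k) => n kn; apply: trunc_log_large.
apply: leq_trans (ltnW (trunc_log_lt_w _)); first exact: trunc_log_large.
by apply: leq_trans kn; rewrite expn_gt0.
Qed.

Lemma eventually_large : exists N, forall n, N <= n ->
  [/\ large n, 0 < fanout n & total_size n * w n * fanout n <= 2 * n * fanout n + excess_factor * n].
Proof.
have [N0 hN0] := w_small.
have [Nv hNv] := polynomial_le_exp 4 (1000 * c).
(* This is applied at [L %/ 4]; the factor 8 is there because [L <= 8 * (L %/ 4)] once [4 <= L]. *)
have [NL hNL] := polynomial_le_exp 5 (1000 * (c * 8) ^ 5).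
have [N1 hN1] := fanout_large (maxn Nv 3).
exists (maxn (maxn N0 N1) (2 ^ (maxn (maxn 4 (4 * NL)) (excess_factor + 2)))) => n.
rewrite !geq_max => /andP[/andP[n0 n1] nlog].
have npos : 0 < n by apply: leq_trans nlog; rewrite expn_gt0.
have Llarge := trunc_log_large nlog; rewrite !geq_max in Llarge.
have [/andP[L4 LNL] Lex] := andP Llarge.
set L := trunc_log 2 n in L4 LNL Lex.
have nL : 2 ^ L <= n := trunc_logP (ltnSn 1) npos.
have LW : L < w n := trunc_log_lt_w npos.
have WL : w n <= c * L := hN0 _ n0.
have [v1 v2] := andP (trunc_log_bounds (ltnSn 1) (leq_ltn_trans (leq0n _) LW)).
have := hN1 _ n1; rewrite geq_max => /andP[vN v3].
have v_large := hNv _ vN.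
have L_large : 1000 * (c * L) ^ 5 <= 2 ^ (L %/ 4).
  have q_ge : NL <= L %/ 4 by rewrite leq_divRL // mulnC.
  apply: leq_trans (hNL _ q_ge); rewrite -mulnA leq_mul2l /= -expnMn leq_exp2r // -mulnA leq_mul2l.
  by apply/orP; right; move: L4; clear; move: L => l; lia.
have W_large : excess_factor + 2 <= w n by apply: leq_trans Lex (ltnW LW).
split; last 1 first.
- exact: (size_bound nL WL LW v1 v2 erefl v_large v3 L_large W_large).
- apply/and5P; split.
  + by apply: leq_ltn_trans (v_lt_b nL WL LW v1 v2 erefl v_large v3 L_large W_large).
  + exact: ltnW (ltnW v3).
  + exact: (chunk_gt1 nL WL LW v1 v2 (erefl (micro_len n)) v_large v3 L_large W_large).
  + exact: (fields_ok nL WL LW v1 v2 erefl v_large v3 L_large W_large).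
  + apply/andP; split; first exact: (field_ok nL WL LW v1 v2 erefl v_large v3 L_large W_large).
    apply: leq_ltn_trans (w_fits n).
    exact: (size_le nL WL LW v1 v2 erefl v_large v3 L_large W_large).
- exact: ltnW (ltnW v3).
Qed.

(** The actual excess, so that the space bound holds at every length, and only its growth needs
    proof. The [n.+1] words are the flag and the plain array. *)
Definition redundancy n := (if large n then total_size n else n.+1) * w n - 2 * n.

Lemma redundancy_little_o : little_o_n redundancy.
Proof.
move=> eps eps0; have [N1 hN1] := eventually_large.
(* Chosen so that [excess_factor < eps * k]; the fanout eventually exceeds any [k]. *)
pose k := (Num.truncn (excess_factor%:R / eps)%R).+1.
have [N2 hN2] := fanout_large k.
exists (maxn N1 N2) => n; rewrite geq_max => /andP[n1 n2].
have [lg v0 bound] := hN1 _ n1.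
have le1 : redundancy n * k <= excess_factor * n.
  apply: (@leq_trans (redundancy n * fanout n)); first by rewrite leq_mul2l hN2 ?orbT.
  by rewrite /redundancy lg mulnBl leq_subLR.
have kP : (excess_factor%:R < eps * k%:R)%R.
  by rewrite mulrC -ltr_pdivrMr //; apply: truncnS_gt.
rewrite -(ler_pM2r (ltr0Sn rat k.-1 : (0 < k%:R)%R)) mulrAC -natrM.
apply: (@le_trans _ _ ((excess_factor * n)%:R : rat)%R); first by rewrite ler_nat.
by rewrite natrM; apply: ler_wpM2r; [exact: ler0n | exact: ltW].
Qed.

End Asymptotics.

Theorem theorem1 (w : nat -> nat) (hw : log_word_size w) :
  exists (P : program) (t : nat) (r : nat -> nat),
    little_o_n r /\
    forall (d : Order.disp_t) (A : orderType d) (n : nat) (T : n.-tuple A),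
      dollar_terminated T ->
      exists M : seq nat,
        [/\ all (is_word (w n)) M,
            size M * w n <= 2 * n + r n
          & forall i, i < n ->
              answers (w n) P t M i (nth 0 (lyndon_array T) i)].
Proof.
have [w_fits [C [N hN]]] := hw.
have w_small : exists N, forall n, N <= n -> w n <= C.+1 * trunc_log 2 n.
  by exists N => n /hN le; apply: leq_trans le _; rewrite leq_mul2r leqnSn orbT.
(* [query] reads all parameters from memory, so a single program serves every length and word
   size. *)
exists (compile 0 query), (size (compile 0 query)), (redundancy w C.+1).
split; first exact: redundancy_little_o.
move=> d A n T _; pose next i := i + longest_lyndon T i.
have sz : size T = n by rewrite size_tuple.
have next_gt i : i < n -> i < next i <= n.
  rewrite -sz => /longest_lyndonP[l0 lT _ _]; rewrite lT andbT.
  by rewrite -[X in X < _]addn0 ltn_add2l.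
have next_nc i j : j < n -> i < j < next i -> next j <= next i.
  by rewrite -sz; apply: longest_lyndon_noncrossing.
have answerE i : i < n -> nth 0 (lyndon_array T) i = next i - i.
  by move=> lt_in; rewrite nth_mkseq ?sz // addKn.
have fits : size (lyndon_array T) < 2 ^ w n by rewrite size_mkseq sz; apply: w_fits.
have size_ok S : S * w n <= 2 * n + (S * w n - 2 * n) by rewrite -leq_subLR.
case: (boolP (large w C.+1 n)) => lg; last first.
  exists (0 :: lyndon_array T); split.
  - rewrite /= /is_word expn_gt0 /=; apply/allP=> a /mapP[i]; rewrite mem_iota => lt_in ->.
    have [_ lT _ _] := longest_lyndonP (lt_in : i < size T).
    apply: leq_ltn_trans (w_fits n); by rewrite sz in lT; apply: leq_trans (leq_addl _ _) lT.
  - by rewrite /redundancy (negPf lg) /= size_mkseq sz.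
  - by move=> i lt_in; apply: plain_answers; rewrite // size_mkseq sz.
have /and5P[b0 f0 ch fields /andP[field total]] := lg.
pose M := memory n (height n next) (threshold n next) (micro_len w C.+1 n) (fanout w n)
  (chunk_len w n) (num_chunks w C.+1 n) (codes_per_word C.+1) (field_width w n).
have M_size : size M = total_size w C.+1 n by apply: size_memory.
have M_fits : size M < 2 ^ w n by rewrite M_size.
have c0_gt1 : 1 < codes_per_word C.+1 by rewrite /codes_per_word; clear; lia.
have codes_fit : 2 * micro_len w C.+1 n * codes_per_word C.+1 <= w n.
  by rewrite mulnAC mulnC; apply: leq_trunc_div.
have chunk_fits : field_width w n * chunk_len w n <= w n by rewrite mulnC; apply: leq_trunc_div.
have m_le : (2 * block_len (micro_len w C.+1 n) (fanout w n)).+1 <= num_chunks w C.+1 n * chunk_len w n.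
  by apply: ltn_ceil; apply: ltnW ch.
have n_fits : n < 2 ^ w n by apply: w_fits.
have V_le_h : forall i, height n next i <= threshold n next i by apply: height_le_threshold.
have h_le_V : forall i, threshold n next i <= (height n next i).+1 by apply: threshold_le_height.
have VS_le_h : forall i, height n next i.+1 <= threshold n next i.
  by apply: height_succ_le_threshold.
have h_le_VS : forall i, threshold n next i <= (height n next i.+1).+1.
  by apply: threshold_le_height_succ.
have V_out i : n <= i -> height n next i = 0 by apply: height_out.
have V0 : height n next 0 = 0 by apply: height0.
exists M; split.
- by apply: memory_words => //; apply: ltnW ch.
- by rewrite M_size /redundancy lg.
- move=> i lt_in; rewrite answerE //; apply: structure_answers => //; first exact: ltnW ch.
  have /andP[gt _] := next_gt _ lt_in; split=> //; first exact: height_next_lt_threshold.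
  by move=> k hk; apply: threshold_le_before.
Qed.
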